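(* Let $\alpha\in(0,2)$, $\alpha\ne 1$, and let $W_j\sim\mathcal{N}(0,\sigma_W^2)$ with $\sigma_W>0$. With $B_1(c,\alpha)$, $K(a)$, $\bar g$ and $Z_{(c,\infty)}$ as in the context and $Z\sim\mathcal{N}(0,1)$, as $c\to\infty$, $$B_1(c,\alpha)\sim\frac{K(a)}{\bar g^2}\left(\frac1{c-1}\right),$$ so that $$\Delta(Z_{(c,\infty)},Z)=O\left(\frac1c\right),$$ where $\Delta(Z_{(c,\infty)},Z):=\sup_{x\in\mathbb{R}}|\mathbb{P}(Z_{(c,\infty)}\le x)-\mathbb{P}(Z\le x)|$.
   Context: Notation $f_1(c)\sim f_2(c)$ means $\lim_{c\to\infty}f_1(c)/f_2(c)=1$. Lower and upper incomplete gamma functions: $\gamma(s,x)=\int_0^x t^{s-1}e^{-t}\,dt$ and $\Gamma(s,x)=\int_x^\infty t^{s-1}e^{-t}\,dt$. Set $a=\alpha/2$, $\eta=(1-a)/a$, $g(w):=1-e^{-w}-w^a\gamma(1-a,w)$ for $w\ge0$, $\bar\gamma(a):=\gamma(1-a,1)$, $\bar g:=g(1)$, $$K(a):=\frac1\pi\left[\frac{a}{2(2-a)}+\frac1{\eta^2}\right],$$ and for $c>1$ $$B_1(c,\alpha):=\frac{cK(a)}{c-1}\left[\frac{1}{(c-1)\bar g^2}+\left(\frac1{\bar g}-\frac{1}{(c-1)\bar g^2}\right)e^{(c-1)\bar g}+\frac{(c-1)\,e^{(c-1)(1-e^{-1})}}{a\,[(c-1)\bar\gamma(a)]^{2/a}}\,\Gamma\!\left(\tfrac2a,(c-1)\bar\gamma(a)\right)\right].$$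 Let $\{\Gamma_j\}_{j\ge1}$ be the successive arrival times of a unit rate Poisson process on $(0,\infty)$ and let $\{W_j\}_{j\ge1}$ be i.i.d. $\mathcal{N}(0,\sigma_W^2)$ independent of $\{\Gamma_j\}$. For $c>0$, $R_{(c,\infty)}$ is the limit in distribution, as $d\to\infty$, of $R_{(c,d)}:=\sum_{j:\Gamma_j\in(c,d)}W_j\Gamma_j^{-1/\alpha}$ (this limit exists); $S^2_{(c,\infty)}:=\sigma_W^2\frac{\alpha}{2-\alpha}c^{(\alpha-2)/\alpha}$; and $Z_{(c,\infty)}:=R_{(c,\infty)}/S_{(c,\infty)}$. *)

(* Defs.v *)
From HB Require Import structures.
From mathcomp Require Import all_boot all_order all_algebra finmap.
From mathcomp Require Import all_classical all_reals all_analysis.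
From mathcomp Require Import measurable_realfun.

Set Implicit Arguments.
Unset Strict Implicit.
Unset Printing Implicit Defensive.

Import Order.TTheory GRing.Theory Num.Theory.
Import numFieldNormedType.Exports.

Local Open Scope classical_set_scope.
Local Open Scope ring_scope.

(* Needed by the Landau notation f =O_+oo g. *)
Canonical pinfty_filter_on (R : numFieldType) :=
  FilterType (pinfty_nbhs R) _.

Section bound.
Context {R : realType}.
Implicit Types a alpha c s w x : R.

(* The integrand is 0 instead of +oo at t = 0 when s < 1, a null set. *)
Definition lower_gamma s x : R :=
  \int[lebesgue_measure]_(t in `[0, x]) (t `^ (s - 1) * expR (- t)).

Definition upper_gamma s x : R :=
  \int[lebesgue_measure]_(t in `[x, +oo[) (t `^ (s - 1) * expR (- t)).

Definition eta a : R := (1 - a) / a.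

Definition g a w : R := 1 - expR (- w) - w `^ a * lower_gamma (1 - a) w.

Definition gamma_bar a : R := lower_gamma (1 - a) 1.

Definition g_bar a : R := g a 1.

Definition K a : R := pi^-1 * (a / (2 * (2 - a)) + (eta a ^+ 2)^-1).

(* The parameter of all the quantities above is a = alpha / 2. *)
Definition B1 c alpha : R :=
  let a := alpha / 2 in
  c * K a / (c - 1) *
  (((c - 1) * g_bar a ^+ 2)^-1
   + ((g_bar a)^-1 - ((c - 1) * g_bar a ^+ 2)^-1) * expR ((c - 1) * g_bar a)
   + (c - 1) * expR ((c - 1) * (1 - expR (- 1)))
     / (a * ((c - 1) * gamma_bar a) `^ (2 / a))
     * upper_gamma (2 / a) ((c - 1) * gamma_bar a)).

End bound.

Section probability_notions.
Context {R : realType}.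

Section one_space.
Context d (T : measurableType d) (P : probability T R).
Implicit Types X Y : nat -> {RV P >-> R}.

Definition has_law (X : {RV P >-> R}) (mu : set R -> \bar R) : Prop :=
  forall A : set R, measurable A -> distribution P X A = mu A.

Definition mutually_independent X : Prop :=
  forall (J : {fset nat}) (B : nat -> set R), (forall j, measurable (B j)) ->
    P (\bigcap_(j in [set` J]) (X j @^-1` B j)) =
    (\prod_(j <- J) P (X j @^-1` B j))%E.

Definition sigma_seq X : set (set T) :=
  <<s \bigcup_j preimage_set_system setT (X j) measurable >>.

Definition independent_seq X Y : Prop :=
  forall A B : set T, sigma_seq X A -> sigma_seq Y B ->
    P (A `&` B) = (P A * P B)%E.

(* Exactly k arrivals in ]s, t]; arrivals are numbered from 0, so that X 0 is
   the first one. *)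
Definition arrivals_eq X (s t : R) (k : nat) : set T :=
  [set w | ([set j | (s < X j w <= t)%R] #= `I_k)%card].

(* X enumerates in increasing order the points of a point process whose counts
   have independent increments, the count in ]s, t] being Poisson (t - s). *)
Definition unit_poisson_arrivals X : Prop :=
  [/\ {ae P, forall w, 0 < X 0 w /\ forall j, X j w < X j.+1 w},
      (forall (s t : R) (k : nat), 0 <= s -> s < t ->
         P (arrivals_eq X s t k) = (poisson_pmf (t - s) k)%:E)
    & (forall (n : nat) (t : nat -> R) (k : nat -> nat),
         0 <= t 0 -> (forall i, t i < t i.+1) ->
         P (\bigcap_(i in `I_n) arrivals_eq X (t i) (t i.+1) (k i)) =
         (\prod_(i < n) P (arrivals_eq X (t i) (t i.+1) (k i)))%E)].

End one_space.

Section two_spaces.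
Context d1 (T1 : measurableType d1) (P1 : probability T1 R).
Context d2 (T2 : measurableType d2) (P2 : probability T2 R).

(* Convergence of the distribution functions at the continuity points of the
   limit. *)
Definition cvg_in_law (I : Type) (F : set_system I)
    (X : I -> {RV P1 >-> R}) (Y : {RV P2 >-> R}) : Prop :=
  forall x : R, {for x, continuous (cdf Y)} ->
    cdf (X i) x @[i --> F] --> cdf Y x.

Definition kolmogorov_dist (X : {RV P1 >-> R}) (Y : {RV P2 >-> R}) : R :=
  sup [set `|fine (cdf X x) - fine (cdf Y x)| | x in [set: R]].

End two_spaces.
End probability_notions.

Lemma measurable_fsum {R : realType} d (T : measurableType d)
    (f : nat -> T -> R) : (forall j, measurable_fun setT (f j)) ->
  measurable_fun setT (fun w => \sum_(j \in setT) f j w).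
Proof.
move=> mf.
pose E n : set T := \bigcap_(j in [set j | (n <= j)%N]) (f j @^-1` [set 0]).
have mE n : measurable (E n).
  apply: bigcap_measurable; first by exists n => /=.
  by move=> j _; rewrite -[X in measurable X]setTI; exact: mf.
pose h n w := (\1_(E n) w : R) * \sum_(j < n) f j w.
apply: (@measurable_fun_cvg _ _ _ _ h).
  move=> n; apply: measurable_funM; first exact: measurable_indic.
  exact: measurable_sum.
move=> w _.
have [[N EN]|nE] := pselect (exists n, E n w).
  apply: cvg_near_cst; exists N => // n /= Nn.
  have En : E n w by move=> j /= nj; apply: EN; exact: leq_trans nj.
  rewrite /h indicE mem_set// mul1r (fsbig_ord _ n (f ^~ w)).
  apply: fsbig_widen => // j [_ /= /negP]; rewrite -leqNgt => nj.
  exact: En.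
have -> : \sum_(j \in setT) f j w = 0.
  apply: fsbig_dflt => fin.
  apply: nE.
  exists (\max_(i <- fset_set (setT `&` (f ^~ w) @^-1` [set~ 0])) i).+1.
  move=> j /= ltj; apply: contrapT => fj.
  have jin : j \in fset_set (setT `&` (f ^~ w) @^-1` [set~ 0]).
    by rewrite in_fset_set// inE.
  by move: ltj; rewrite ltnNge; apply/negP/negPn/leq_bigmax_seq.
apply: cvg_near_cst; apply: nearW => n.
by rewrite /h indicE memNset ?mul0r// => En; apply: nE; exists n.
Qed.

Section series.
Context {R : realType} d (T : measurableType d) (P : probability T R).
Variables (W Gam : nat -> {RV P >-> R}) (alpha c e : R).

(* R_(c, e); the sum has finite support almost surely, and is 0 otherwise. *)
Definition truncated_series (w : T) : R :=
  \sum_(j \in [set j | c < Gam j w < e]) W j w * Gam j w `^ (- alpha^-1).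

Let measurable_truncated_series : measurable_fun setT truncated_series.
Proof.
pose f j w := W j w * Gam j w `^ (- alpha^-1) * \1_`]c, e[ (Gam j w).
have -> : truncated_series = fun w => \sum_(j \in setT) f j w.
  apply/funext => w; rewrite /truncated_series fsbig_mkcond.
  apply: eq_fsbigr => j _; rewrite /f /patch indicE.
  case: ifPn => [|]; rewrite ?inE ?notin_setE /= => cj.
    by rewrite mem_set ?mulr1//= in_itv.
  by rewrite memNset ?mulr0//= in_itv.
apply: measurable_fsum => j; apply: measurable_funM.
  apply: measurable_funM => //.
  by apply: (measurableT_comp (measurable_powR _)).
by apply: (measurableT_comp (measurable_indic (measurable_itv `]c, e[))).
Qed.

HB.instance Definition _ := isMeasurableFun.Build _ _ T R truncated_series
  measurable_truncated_series.

Definition truncated_RV : {RV P >-> R} := truncated_series.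

End series.

(* S_(c, oo), the square root of the variance of R_(c, oo). *)
Definition S_inf {R : realType} (sigma alpha c : R) : R :=
  Num.sqrt (sigma ^+ 2 * (alpha / (2 - alpha)) * c `^ ((alpha - 2) / alpha)).

Definition standardize {R : realType} d (T : measurableType d)
    (P : probability T R) (s : R) (X : {RV P >-> R}) : {RV P >-> R} :=
  s^-1 \o* X.

(* Main.v *)
(* Given the arrival times, a sum [sum_j W_j f(Gam_j)] is a centred Gaussian
   with variance [sigma^2 V], where [V = sum_j f(Gam_j)^2].  With [mu = E V],
   the distribution function of the normalized sum at [y] is therefore
   [E Phi(y / sqrt (V / mu))].  Expanding in [V / mu] around 1, uniformly in
   [y], the linear term has expectation 0 and the error is at most
   [C Var V / mu^2 <= C (sup f^2) / mu].  For [f x = x^(-1/alpha)] on ]c, e],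
   approximated by step functions, [sup f^2 = c^(-2/alpha)] and [mu] tends to
   [alpha / (2 - alpha) * c^(1 - 2/alpha)] as e grows, which gives O(1/c).

   For B1, the point is that [g_bar < 0]: both the exponential and the
   incomplete gamma summands are then exponentially small in c. *)

Require Import Defs.
From HB Require Import structures.
From mathcomp Require Import all_boot all_order all_algebra finmap.
From mathcomp Require Import all_classical all_reals all_analysis.
From mathcomp Require Import measurable_realfun.
From mathcomp Require Import ring lra.

Set Implicit Arguments.
Unset Strict Implicit.
Unset Printing Implicit Defensive.

Import Order.TTheory GRing.Theory Num.Theory.
Import numFieldNormedType.Exports.

Local Open Scope classical_set_scope.
Local Open Scope ring_scope.

(** * The normal distribution function *)

Section gaussian_cdf.
Context {R : realType}.
Implicit Types (x y u v m s : R).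
Local Notation mu := (@lebesgue_measure R).
Local Notation phi := (@normal_pdf R 0 1).
Local Notation p := (@normal_peak R 1).

(** The obstacle is the conditioning on the arrival times, which form an infinite and continuous
    family. Keeping the first [n] arrivals and step functions [f] leaves finitely many coefficient
    vectors: conditioning becomes a finite sum over cell patterns, and the random variance becomes a
    combination of counts, whose first two moments the Poisson law gives. Cutting at [n] arrivals
    costs the probability of a later arrival in ]c, e], which tends to 0. The grid values are mean
    value points, so that the mean variance is exact at every mesh and the discretization leaves no
    error in the bound. Uniformity in [y] comes from a bound on [|y|^3 phi(y u)] for [u] in
    [1/2, 2]; for variances far from 1 the quadratic remainder dominates trivial bounds. Finally,
    [g_bar < 0] amounts to [gamma_bar > 1 - e^-1], which holds because [t^(-a) > 1] on ]0, 1[. *)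

Definition Phi x : R := fine (normal_prob 0 1 `]-oo, x]).

Lemma PhiE x : normal_prob 0 1 `]-oo, x] = (Phi x)%:E.
Proof. by rewrite fineK// fin_num_measure. Qed.

Lemma Phi_ge0 x : 0 <= Phi x.
Proof. by rewrite -lee_fin -PhiE. Qed.

Lemma Phi_le1 x : Phi x <= 1.
Proof. by rewrite -lee_fin -PhiE probability_le1. Qed.

Lemma normal_prob_Nycc m s x : 0 < s ->
  normal_prob m s `]-oo, x] = (Phi ((x - m) / s))%:E.
Proof.
move=> s0; rewrite -PhiE /normal_prob.
pose F (y : R^o) : R^o := (y - m) / s.
have F'E : F^`()%classic = cst s^-1.
  apply/funext => y; rewrite /F derive1E deriveM// deriveB// derive_cst scaler0.
  by rewrite add0r derive_id derive_cst subr0 scaler1.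
rewrite (@increasing_ge0_integration_by_substitutionNy R F (normal_pdf 0 1) x).
- apply: eq_integral => y _; congr EFin; rewrite F'E /=.
  rewrite !normal_pdfE ?gt_eqF// /normal_peak /normal_fun /= expr1n mul1r.
  rewrite -mulrnAr sqrtrM ?sqr_ge0// sqrtr_sqr gtr0_norm// invfM /F.
  have -> : - (y - m) ^+ 2 / (s ^+ 2 *+ 2) = - ((y - m) / s) ^+ 2 / 2 :> R.
    by rewrite -mulr_natr; field; rewrite gt_eqF.
  rewrite /= !fctE /= subr0 mulrC [s^-1 / _]mulrC mulrA; congr (_ * _).
  by rewrite mulrC.
- by move=> y z _ _ yz; rewrite ltr_pM2r ?invr_gt0// ltrD2r.
- by rewrite F'E => ? _; exact: cvg_cst.
- by rewrite F'E; exact: is_cvg_cst.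
- by rewrite F'E; exact: cvg_cst.
- split; first by [].
  apply: cvgM; last exact: cvg_cst.
  by apply: cvgB; [apply: cvg_at_left_filter; exact: cvg_id|exact: cvg_cst].
- by apply/gt0_cvgMlNy; [rewrite invr_gt0|exact: cvg_addrr_Ny].
- by apply: continuous_subspaceT => ?; exact: continuous_normal_pdf.
- by move=> y _; exact: normal_pdf_ge0.
Qed.


Lemma Phi_subE x y : x <= y ->
  (Phi y - Phi x)%:E = (\int[mu]_(t in `]x, y]) (phi t)%:E)%E.
Proof.
move=> xy; rewrite EFinB -!PhiE (@itv_bndbnd_setU _ _ _ (BRight x)) ?bnd_simp//.
rewrite measureU//; last first.
  apply/seteqP; split => // t; rewrite /= !in_itv/= => -[tx /andP[xt _]].
  by move: tx; rewrite leNgt xt.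
by rewrite addrAC subee ?fin_num_measure// add0e.
Qed.

Lemma Phi_sub_ge x y (m : R) : x <= y -> (forall t, x < t <= y -> m <= phi t) ->
  m * (y - x) <= Phi y - Phi x.
Proof.
rewrite le_eqVlt => /predU1P[<- _|xy mphi]; first by rewrite !subrr mulr0.
have [m0|m0] := leP m 0.
  apply: (@le_trans _ _ 0); first by rewrite mulr_le0_ge0// subr_ge0 ltW.
  rewrite -lee_fin (Phi_subE (ltW xy)); apply: integral_ge0 => t _.
  by rewrite lee_fin normal_pdf_ge0.
rewrite -lee_fin (Phi_subE (ltW xy)).
have -> : (m * (y - x))%:E = (\int[mu]_(t in `]x, y]) (cst m%:E) t)%E.
  by rewrite integral_cst//= EFinM lebesgue_measure_itv/= lte_fin xy EFinB.
apply: ge0_le_integral => //=.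
- by move=> t _; rewrite lee_fin ltW.
- apply/measurable_EFinP; apply: measurable_funTS; exact: measurable_normal_pdf.
Qed.

Lemma Phi_sub_le x y (M : R) : x <= y -> (forall t, x < t <= y -> phi t <= M) ->
  Phi y - Phi x <= M * (y - x).
Proof.
move=> xy; rewrite le_eqVlt in xy; case/predU1P : xy => [-> _|xy Mphi].
  by rewrite !subrr mulr0.
have M0 : 0 <= M.
  by apply: le_trans (Mphi y _); rewrite ?normal_pdf_ge0// xy lexx.
rewrite -lee_fin (Phi_subE (ltW xy)).
have -> : (M * (y - x))%:E = (\int[mu]_(t in `]x, y]) (cst M%:E) t)%E.
  by rewrite integral_cst//= EFinM lebesgue_measure_itv/= lte_fin xy EFinB.
apply: ge0_le_integral => //=.
- by move=> t _; rewrite lee_fin normal_pdf_ge0.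
- apply/measurable_EFinP; apply: measurable_funTS; exact: measurable_normal_pdf.
Qed.

Let p0 : 0 < p. Proof. by rewrite normal_peak_gt0 ?oner_neq0. Qed.

Lemma phiE x : phi x = p * expR (- (x ^+ 2 / 2)).
Proof. by rewrite normal_pdfE ?oner_neq0// /normal_fun subr0 expr1n mulNr. Qed.

Lemma Phi_lipschitz x y : `|Phi y - Phi x| <= p * `|y - x|.
Proof.
wlog xy : x y / x <= y => [hw|].
  have [xy|/ltW yx] := leP x y; first exact: hw.
  by rewrite distrC [in leRHS]distrC; exact: hw.
rewrite [X in _ * X]ger0_norm ?subr_ge0//.
have := @Phi_sub_ge x y 0 xy (fun t _ => normal_pdf_ge0 _ _ _).
rewrite mul0r => h; rewrite ger0_norm//.
by apply: Phi_sub_le => // t _; rewrite normal_pdf_ub ?oner_neq0.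
Qed.

Lemma Phi_continuous : continuous (Phi : R -> R).
Proof.
move=> x; apply/cvgrPdist_le => e e0; near=> y.
rewrite (le_trans (Phi_lipschitz _ _))// mulrC -ler_pdivlMr//.
near: y; apply: cvgr_dist_le; first exact: cvg_id.
by rewrite divr_gt0.
Unshelve. all: by end_near. Qed.

Lemma Phi_le x y : x <= y -> Phi x <= Phi y.
Proof.
move=> xy; rewrite -subr_ge0.
have := @Phi_sub_ge x y 0 xy (fun t _ => normal_pdf_ge0 _ _ _).
by rewrite mul0r.
Qed.

Lemma expRN_dist (A B m : R) : m <= A -> m <= B ->
  `|expR (- A) - expR (- B)| <= `|A - B| * expR (- m).
Proof.
wlog AB : A B / A <= B => [hw mA mB|mA _].
  have [AB|/ltW BA] := leP A B; first exact: hw.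
  by rewrite distrC [X in X * _]distrC; exact: hw.
rewrite ger0_norm ?subr_ge0 ?ler_expR ?lerN2// distrC ger0_norm ?subr_ge0//.
have -> : expR (- B) = expR (- A) * expR (- (B - A)).
  by rewrite -expRD; congr expR; ring.
rewrite -[X in X - _]mulr1 -mulrBr mulrC ler_pM ?expR_ge0 ?ler_expR ?lerN2//.
  by rewrite subr_ge0 -expR0 ler_expR oppr_le0 subr_ge0.
by have := expR_ge1Dx (- (B - A)); lra.
Qed.

(* Bounds the second derivative of [u |-> Phi (x * u)], which is
   [- x ^+ 3 * u * phi (x * u)], uniformly in [x]. *)
Lemma cube_le_expR x : `|x| ^+ 3 * expR (- (x ^+ 2 / 8)) <= 257.
Proof.
rewrite expRN ler_pdivrMr ?expR_gt0//.
set y := x ^+ 2 / 8.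
have y0 : 0 <= y by rewrite divr_ge0 ?sqr_ge0.
have e1 : 1 <= expR y by rewrite -expR0 ler_expR.
have e2 : (1 + y / 2) ^+ 2 <= expR y.
  have -> : expR y = expR (y / 2) ^+ 2 by rewrite -expRM_natl; congr expR; field.
  by have := expR_ge1Dx (y / 2); move: (expR _) => e he; nra.
have xy : `|x| ^+ 2 = 8 * y by rewrite real_normK ?num_real// /y; field.
(* By [e2], [64 * y ^+ 2 <= 256 * expR y], and [1 <= expR y] by [e1]: hence [257]. *)
have : `|x| ^+ 3 <= 1 + 64 * y ^+ 2.
  have h (a : R) : 0 <= a -> a ^+ 3 <= 1 + a ^+ 4.
    move=> a0; have [a1|/ltW a1] := leP a 1.
      by rewrite (le_trans (exprn_ile1 _ a0 a1))// lerDl exprn_ge0.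
    apply: (@le_trans _ _ (a ^+ 4)); last by rewrite lerDr.
    by apply: ler_weXn2l.
  have -> : 64 * y ^+ 2 = `|x| ^+ 4 by rewrite -[4%N]/(2 * 2)%N exprM xy; ring.
  exact: h.
nra.
Qed.

Lemma abs_mul_phi x : `|x| * phi x <= p.
Proof.
rewrite phiE mulrCA ler_piMr ?(ltW p0)// expRN ler_pdivrMr ?expR_gt0// mul1r.
apply: le_trans (expR_ge1Dx _).
rewrite -(real_normK (num_real x)); move: (`|x| : R) => a; nra.
Qed.

(** The error is uniform in [x] because the Gaussian factor absorbs [x ^+ 3]: it stays below
    [expR (- (x ^+ 2 / 8))] as long as [u >= 1 / 2]. *)
Lemma Phi_taylor x u : 2^-1 <= u <= 2 ->
  `|Phi (x * u) - Phi x - x * phi x * (u - 1)| <= 386 * p * (u - 1) ^+ 2.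
Proof.
move=> /andP[u1 u2].
set y := x * u.
(* Bounds the oscillation of [phi] between [x] and [x * u]: at [t = x * w] the exponents differ by
   [x ^+ 2 * |w - 1| * (w + 1) / 2], where [(w + 1) / 2 <= 3 / 2], and both are at least
   [x ^+ 2 / 8]. *)
pose D : R := p * (3 / 2 * (x ^+ 2 * `|u - 1|)) * expR (- (x ^+ 2 / 8)).
(* The sign condition says that [t] lies between [x] and [y], in either order. *)
have hD t : (t - x) * (t - y) <= 0 -> `|phi t - phi x| <= D.
  move=> txy; rewrite !phiE -mulrBr normrM gtr0_norm// /D -mulrA ler_pM2l//.
  have [w [tw w1 w2]] : exists w, [/\ t = x * w, 2^-1 <= w <= 2 & `|w - 1| <= `|u - 1|].
    have [x0|x0] := eqVneq x 0.
      exists 1; rewrite mulr1 subrr normr0 normr_ge0; split => //; last by lra.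
      by move: txy; rewrite /y x0 !(mul0r, subr0); nra.
    have x2 : 0 < x ^+ 2 by rewrite exprn_even_gt0.
    exists (t / x).
    have tw : t = x * (t / x) by rewrite mulrC divfK.
    move: tw txy; rewrite /y; set w := t / x => -> txy.
    have : (w - 1) * (w - u) <= 0.
      rewrite -(pmulr_rle0 _ x2); move: txy.
      by have -> // : (x * w - x) * (x * w - x * u) = x ^+ 2 * ((w - 1) * (w - u)) by ring.
    move=> wu; have [u0|u0] := leP 1 u.
      have ? : 1 <= w <= u by nra.
      by split => //; rewrite ?ger0_norm; lra.
    have ? : u <= w <= 1 by nra.
    by split => //; rewrite ?ler0_norm; lra.
  have x2 := sqr_ge0 x; have w4 : 4^-1 <= w ^+ 2 by case/andP: w1; nra.
  apply: le_trans (@expRN_dist _ _ (x ^+ 2 / 8) _ _) _; rewrite ?tw ?exprMn.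
  - by move: (x ^+ 2) (w ^+ 2) x2 w4 => X W; nra.
  - by lra.
  rewrite ler_pM2r ?expR_gt0//.
  have -> : x ^+ 2 * w ^+ 2 / 2 - x ^+ 2 / 2 = x ^+ 2 * ((w - 1) * ((w + 1) / 2)) by field.
  rewrite normrM ger0_norm ?sqr_ge0// normrM [leRHS]mulrCA ler_wpM2l ?sqr_ge0//.
  by rewrite mulrC ler_pM// ger0_norm; lra.
have D0 : 0 <= D.
  rewrite /D mulr_ge0 ?expR_ge0// mulr_ge0 ?(ltW p0)//.
  apply: mulr_ge0; first by rewrite divr_ge0.
  by apply: mulr_ge0; [exact: sqr_ge0|exact: normr_ge0].
have yx : y - x = x * (u - 1) by rewrite /y; ring.
have bound : `|Phi y - Phi x - phi x * (y - x)| <= D * `|y - x|.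
  have [xy|/ltW yx'] := leP x y.
    rewrite (@ger0_norm _ (y - x)) ?subr_ge0// ler_norml.
    have hD' t : x < t <= y -> `|phi t - phi x| <= D.
      by move=> /andP[? ?]; apply: hD; nra.
    have := @Phi_sub_le x y (phi x + D) xy; have := @Phi_sub_ge x y (phi x - D) xy.
    have h1 t : x < t <= y -> phi x - D <= phi t.
      by move=> /hD'; rewrite ler_norml; lra.
    have h2 t : x < t <= y -> phi t <= phi x + D.
      by move=> /hD'; rewrite ler_norml; lra.
    by move=> /(_ h1) + /(_ h2); lra.
  rewrite (@ler0_norm _ (y - x)) ?subr_le0// ler_norml.
  have hD' t : y < t <= x -> `|phi t - phi x| <= D.
    by move=> /andP[? ?]; apply: hD; nra.
  have := @Phi_sub_le y x (phi x + D) yx'; have := @Phi_sub_ge y x (phi x - D) yx'.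
  have h1 t : y < t <= x -> phi x - D <= phi t.
    by move=> /hD'; rewrite ler_norml; lra.
  have h2 t : y < t <= x -> phi t <= phi x + D.
    by move=> /hD'; rewrite ler_norml; lra.
  by move=> /(_ h1) + /(_ h2); lra.
have -> : x * phi x * (u - 1) = phi x * (y - x) by rewrite yx; ring.
apply: le_trans bound _; rewrite yx normrM /D.
(* The constant [386] rounds up [3 / 2 * 257]. *)
have key (E a b : R) : a ^+ 3 * E <= 257 ->
    p * (3 / 2 * (a ^+ 2 * b)) * E * (a * b) <= 386 * p * b ^+ 2.
  have -> : p * (3 / 2 * (a ^+ 2 * b)) * E * (a * b) =
    (p * b ^+ 2) * (3 / 2 * (a ^+ 3 * E)) by ring.
  have -> : 386 * p * b ^+ 2 = (p * b ^+ 2) * 386 by ring.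
  by move=> h; apply: ler_wpM2l; [exact: mulr_ge0 (ltW p0) (sqr_ge0 b)|lra].
have := key _ _ `|u - 1| (cube_le_expR x).
by rewrite !real_normK ?num_real.
Qed.

(* Also covers the degenerate variance [v = 0], which occurs when no arrival is
   counted. *)
Definition gcdf v x : R := if 0 < v then Phi (x / Num.sqrt v) else (0 <= x)%R%:R.

Lemma gcdf_ge0 v x : 0 <= gcdf v x.
Proof. by rewrite /gcdf; case: ifP => _; rewrite ?Phi_ge0. Qed.

Lemma gcdf_le1 v x : gcdf v x <= 1.
Proof. by rewrite /gcdf; case: ifP => _; rewrite ?Phi_le1//; case: (0 <= x). Qed.

Lemma gcdf_scale s v x : 0 < s -> gcdf (s ^+ 2 * v) (s * x) = gcdf v x.
Proof.
move=> s0; rewrite /gcdf pmulr_rgt0 ?exprn_gt0//; case: ifP => _.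
  rewrite sqrtrM ?sqr_ge0// sqrtr_sqr gtr0_norm//.
  by rewrite invfM mulrACA divff ?gt_eqF// mul1r.
by rewrite pmulr_rge0.
Qed.

(** Under [v = 1 / u ^+ 2], these factors turn [v - 1] into [1 - u], and [(v - 1) ^+ 2] into
    [u - 1 + (v - 1) / 2]. *)
Let taylor_coef u : 2^-1 <= u <= 2 ->
  0 <= u ^+ 2 / (1 + u) <= 4 /\ 0 <= u ^+ 2 * (1 + 2 * u) / (2 * (1 + u) ^+ 2) <= 10.
Proof.
move=> /andP[u1 u2].
have u0 : 0 < 1 + u by lra.
have uu : u ^+ 2 <= 4 by nra.
have u3 : u ^+ 2 * (1 + 2 * u) <= 4 * 5.
  by apply: ler_pM => //; [exact: sqr_ge0|lra|lra].
have u4 : 1 <= (1 + u) ^+ 2 by nra.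
split; apply/andP; split.
- by apply: divr_ge0; [exact: sqr_ge0|lra].
- by rewrite ler_pdivrMr//; lra.
- by apply: divr_ge0; [apply: mulr_ge0; [exact: sqr_ge0|lra]|lra].
- by rewrite ler_pdivrMr; lra.
Qed.

(** For [v] between 1/4 and 4 the coefficient of [p] is [386 * 16 + 10], rounded up; the [2] pays
    for the other [v], where [1 <= 2 * (v - 1) ^+ 2]. *)
Definition taylor_cst : R := 6200 * p + 2.

Lemma taylor_cst_ge0 : 0 <= taylor_cst.
Proof. by rewrite /taylor_cst; move: p0; lra. Qed.

Lemma gcdf_taylor v x :
  `|gcdf v x - Phi x + x * phi x / 2 * (v - 1)| <= taylor_cst * (v - 1) ^+ 2.
Proof.
rewrite /taylor_cst.
have xp : `|x * phi x| <= p by rewrite normrM (ger0_norm (normal_pdf_ge0 _ _ _)) abs_mul_phi.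
have g0 := gcdf_ge0 v x; have g1 := gcdf_le1 v x.
have P0 := Phi_ge0 x; have P1 := Phi_le1 x.
have pp := p0.
(* Far from 1, the left side is at most [1 + p / 2 * |v - 1|], which the square dominates. This
   covers the degenerate [v <= 0]. *)
have big : `|v - 1| >= 3 / 4 -> `|gcdf v x - Phi x + x * phi x / 2 * (v - 1)| <= (6200 * p + 2) * (v - 1) ^+ 2.
  move=> hv; apply: (@le_trans _ _ (1 + p / 2 * `|v - 1|)).
    apply: le_trans (ler_normD _ _) _; apply: lerD.
      by rewrite ler_norml; lra.
    rewrite normrM ler_wpM2r// normrM [X in _ * X]ger0_norm ?invr_ge0//.
    by rewrite ler_wpM2r ?invr_ge0.
  have key (b : R) : 3 / 4 <= b -> 1 + p / 2 * b <= (6200 * p + 2) * b ^+ 2.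
    move=> hb; have b1 : 1 <= 2 * b ^+ 2 by nra.
    have b2 : b <= 2 * b ^+ 2 by nra.
    have := ler_wpM2l (ltW pp) b2.
    have : 0 <= p * b ^+ 2 by rewrite mulr_ge0 ?sqr_ge0 ?(ltW pp).
    by lra.
  by have := key _ hv; rewrite real_normK ?num_real.
have [v1|v1] := leP v 4^-1; first by apply: big; rewrite ler0_norm; lra.
have [v4|v4] := leP 4 v; first by apply: big; rewrite ger0_norm; lra.
have vp : 0 < v by apply: lt_trans v1.
rewrite /gcdf vp.
have [u uE] : exists u : R, u = (Num.sqrt v)^-1 by eexists.
rewrite -uE.
have u0 : 0 < u by rewrite uE invr_gt0 sqrtr_gt0.
have vu : v = (u ^+ 2)^-1 by rewrite uE exprVn invrK sqr_sqrtr// ltW.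
have uv : u ^+ 2 * v = 1 by rewrite vu mulfV// gt_eqF// exprn_gt0.
have ub : 2^-1 <= u <= 2 by move: u0 uv v1 v4; clear; nra.
have h := Phi_taylor x ub.
have -> : Phi (x * u) - Phi x + x * phi x / 2 * (v - 1) =
  (Phi (x * u) - Phi x - x * phi x * (u - 1)) + x * phi x * (u - 1 + (v - 1) / 2) by field.
apply: le_trans (ler_normD _ _) _.
have e1 : (u - 1) ^+ 2 = (v - 1) ^+ 2 * (u ^+ 2 / (1 + u)) ^+ 2.
  by rewrite vu; field; rewrite !gt_eqF//; lra.
have e2 : u - 1 + (v - 1) / 2 = (v - 1) ^+ 2 * (u ^+ 2 * (1 + 2 * u) / (2 * (1 + u) ^+ 2)).
  by rewrite vu; field; rewrite !gt_eqF//; lra.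
have [b1 b2] := taylor_coef ub.
have b3 : (u - 1) ^+ 2 <= 16 * (v - 1) ^+ 2.
  rewrite e1 mulrC ler_wpM2r ?sqr_ge0//.
  by case/andP: b1; move: (_ / _) => q; clear; nra.
have b4 : `|x * phi x * (u - 1 + (v - 1) / 2)| <= p * (10 * (v - 1) ^+ 2).
  rewrite normrM ler_pM// e2 ger0_norm; last by rewrite mulr_ge0 ?sqr_ge0//; case/andP: b2.
  by rewrite mulrC ler_wpM2r ?sqr_ge0//; case/andP: b2.
have := sqr_ge0 (v - 1); set d := (v - 1) ^+ 2 in b3 b4 *.
move=> d0; have := ler_wpM2l (ltW pp) b3; have := mulr_ge0 (ltW pp) d0.
move: h b4 d0; clear => h b4 d0 h1 h2; lra.
Qed.

End gaussian_cdf.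

(** * Convolution of centred Gaussian laws *)

Section gaussian_convolution.
Context {R : realType}.
Implicit Types (x y a s t : R).
Local Notation mu := (@lebesgue_measure R).

Lemma integral_normal_prob (m s : R) (f : R -> \bar R) :
  measurable_fun setT f -> (\int[normal_prob m s]_x `|f x| < +oo)%E ->
  (\int[normal_prob m s]_x f x = \int[mu]_x (f x * (normal_pdf m s x)%:E))%E.
Proof.
move=> mf finf.
have ndom := normal_prob_dominates m s.
rewrite -(Radon_Nikodym_change_of_variables ndom)//=; last first.
  by apply/integrableP; split.
apply: ae_eq_integral => //.
- apply: emeasurable_funM => //.
- by apply: emeasurable_funM => //; apply/measurable_EFinP; exact: measurable_normal_pdf.
- apply: ae_eqe_mul2l => /=.
  rewrite Radon_NikodymE//=.
  case: cid => /= h [h1 h2 h3].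
  apply: integral_ae_eq => //=.
  + by apply/measurable_EFinP; exact: measurable_normal_pdf.
  + by move=> E E01 mE; rewrite -h3.
Qed.

(** Completing the square: the joint density of [w] and [y = a * w + noise] is the marginal density
    of [y] times the conditional density of [w] given [y]. *)
Lemma normal_pdfM a s t (r w y : R) : 0 < s -> 0 < t -> 0 < r ->
  r ^+ 2 = s ^+ 2 + t ^+ 2 * a ^+ 2 ->
  normal_pdf (a * w) s y * normal_pdf 0 t w =
  normal_pdf 0 r y * normal_pdf (a * t ^+ 2 / r ^+ 2 * y) (s * t / r) w.
Proof.
move=> s0 t0 r0 r2.
have st0 : 0 < s * t / r by rewrite divr_gt0 ?mulr_gt0.
rewrite !normal_pdfE ?gt_eqF// /normal_fun /normal_peak.
rewrite mulrACA [RHS]mulrACA -!expRD; congr (_ * expR _).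
  rewrite -!invfM; congr (_^-1).
  have pos (z : R) : 0 <= z ^+ 2 * pi *+ 2.
    by apply: mulrn_wge0; apply: mulr_ge0; [exact: sqr_ge0|exact: pi_ge0].
  rewrite -!sqrtrM ?pos//; congr (Num.sqrt _).
  by field; rewrite gt_eqF.
have [sn tn rn] : [/\ s != 0, t != 0 & r != 0] by rewrite !gt_eqF.
transitivity (- ((y - a * w) ^+ 2 * t ^+ 2 + w ^+ 2 * s ^+ 2) / (s ^+ 2 * t ^+ 2 *+ 2)).
  by field; rewrite sn tn.
transitivity (- (y ^+ 2 * (s ^+ 2 * t ^+ 2) + (w * r ^+ 2 - a * t ^+ 2 * y) ^+ 2) / r ^+ 2 / (s ^+ 2 * t ^+ 2 *+ 2)); last first.
  by field; rewrite sn tn rn.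
congr (_ / _); apply: (canRL (mulfK _)); first by rewrite expf_neq0.
by rewrite r2; ring.
Qed.

Lemma gcdf_conv_gt0 a s t x : 0 < s -> 0 < t ->
  (\int[normal_prob 0 t]_w (Phi ((x - a * w) / s))%:E =
   (Phi (x / Num.sqrt (s ^+ 2 + t ^+ 2 * a ^+ 2)))%:E)%E.
Proof.
move=> s0 t0.
have r20 : 0 < s ^+ 2 + t ^+ 2 * a ^+ 2 by nra.
have [r [rE r0 r2]] : exists r : R, [/\ Num.sqrt (s ^+ 2 + t ^+ 2 * a ^+ 2) = r, 0 < r &
    r ^+ 2 = s ^+ 2 + t ^+ 2 * a ^+ 2].
  by eexists; split; [reflexivity|rewrite sqrtr_gt0|rewrite sqr_sqrtr// ltW].
rewrite rE.
have mPhi : measurable_fun setT (fun w : R => (Phi ((x - a * w) / s))%:E).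
  apply/measurable_EFinP; apply: (measurableT_comp (continuous_measurable_fun Phi_continuous)).
  by apply: measurable_funM => //; apply: measurable_funB => //; exact: measurable_funM.
rewrite integral_normal_prob//; last first.
  apply: (@le_lt_trans _ _ (\int[normal_prob 0 t]_w cst 1%:E w)%E).
    apply: ge0_le_integral => //.
      exact: measurableT_comp.
    by move=> w _; rewrite abse_EFin lee_fin ger0_norm ?Phi_ge0 ?Phi_le1.
  by rewrite integral_cst// mul1e; apply: (@le_lt_trans _ _ 1%E); [exact: probability_le1|exact: ltry].
have := normal_prob_Nycc 0 x r0; rewrite subr0 => <-; rewrite /normal_prob.
transitivity (\int[mu]_w \int[mu]_y ((\1_`]-oo, x] y)%:E *
   (normal_pdf (a * w) s y * normal_pdf 0 t w)%:E))%E.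
  apply: eq_integral => w _.
  rewrite -(normal_prob_Nycc (a * w) x s0) /normal_prob -ge0_integralZr//; last 3 first.
  - by apply/measurable_EFinP; apply: measurable_funTS; exact: measurable_normal_pdf.
  - by move=> y _; rewrite lee_fin normal_pdf_ge0.
  - by rewrite lee_fin normal_pdf_ge0.
  rewrite integral_mkcond; apply: eq_integral => y _.
  by rewrite patchE indicE EFinM; case: ifP => _; rewrite ?mul1e ?mul0e// muleA.
have pdf_shift (z : R * R) : normal_pdf (a * z.1) s z.2 = normal_pdf 0 s (z.2 - a * z.1).
  by rewrite !normal_pdfE ?gt_eqF// /normal_fun subr0.
pose f (z : measurableTypeR R * measurableTypeR R) :=
  ((\1_`]-oo, x] z.2)%:E * (normal_pdf (a * z.1) s z.2 * normal_pdf 0 t z.1)%:E)%E.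
have mf : measurable_fun setT f.
  apply: emeasurable_funM.
    by apply/measurable_EFinP; apply: (measurableT_comp (measurable_indic _)).
  apply/measurable_EFinP; apply: measurable_funM; last first.
    by apply: (measurableT_comp (measurable_normal_pdf 0 t)).
  under eq_fun do rewrite pdf_shift.
  apply: (measurableT_comp (measurable_normal_pdf 0 s)).
  by apply: measurable_funB => //; exact: measurable_funM.
have f0 z : (0 <= f z)%E.
  rewrite mule_ge0// lee_fin//.
  by apply: mulr_ge0; exact: normal_pdf_ge0.
(* After the exchange, [normal_pdfM] leaves a conditional density in [w], of integral 1. *)
transitivity (\int[mu]_y \int[mu]_w f (w, y))%E; first exact: fubini_tonelli.
rewrite /f {f mf f0}.
rewrite [RHS]integral_mkcond; apply: eq_integral => y _ /=.
rewrite patchE; under eq_integral do rewrite (normal_pdfM _ _ s0 t0 r0 r2) EFinM muleA.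
rewrite ge0_integralZl//; last 3 first.
- by apply/measurable_EFinP; exact: measurable_normal_pdf.
- by move=> w _; rewrite lee_fin normal_pdf_ge0.
- by rewrite mule_ge0// lee_fin// normal_pdf_ge0.
rewrite integral_normal_pdf mule1 indicE.
by case: ifP => _; rewrite ?mul1e ?mul0e.
Qed.

Lemma gcdf_conv a t (v x : R) : 0 <= v -> 0 <= a -> 0 < t ->
  (\int[normal_prob 0 t]_w (gcdf v (x - a * w))%:E =
   (gcdf (v + t ^+ 2 * a ^+ 2) x)%:E)%E.
Proof.
rewrite le_eqVlt => /predU1P[<-|v0].
  rewrite le_eqVlt => /predU1P[<-|a0] t0.
    under eq_integral do rewrite mul0r subr0.
    rewrite integral_cst// expr0n/= mulr0 addr0.
    by rewrite [X in (_ * X)%E]probability_setT mule1.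
  (* With [v = 0] the integrand is the indicator of [w <= x / a]. *)
  rewrite add0r /gcdf ltxx -exprMn exprn_gt0 ?mulr_gt0//.
  rewrite sqrtr_sqr gtr0_norm ?mulr_gt0//.
  have := normal_prob_Nycc 0 (x / a) t0.
  rewrite subr0 -mulrA -invfM [a * t]mulrC => <-.
  transitivity (\int[normal_prob 0 t]_w (\1_`]-oo, x / a] w)%:E)%E; last first.
    by rewrite integral_indic// setIT.
  apply: eq_integral => w _; rewrite indicE mem_setE in_itv/= subr_ge0 mulrC.
  by rewrite ler_pdivlMr.
move=> a0 t0.
have v20 : 0 < v + t ^+ 2 * a ^+ 2 by nra.
rewrite /gcdf v0 v20.
have -> : v = Num.sqrt v ^+ 2 by rewrite sqr_sqrtr// ltW.
rewrite sqrtr_sqr ger0_norm//.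
by apply: gcdf_conv_gt0; rewrite ?sqrtr_gt0.
Qed.

End gaussian_convolution.

(** * Gaussian mixtures *)

Section independent_sums.
Context {R : realType} d (T : measurableType d) (P : probability T R).
Local Open Scope ereal_scope.

(** Two finite measures on the plane agree on rectangles, hence everywhere. The extra event [E] lets
    an induction carry along independence from the variables not yet summed. *)
Lemma joint_law (X Y : {RV P >-> R}) (E : set T) : measurable E ->
  (forall A B, measurable A -> measurable B ->
    P (X @^-1` A `&` Y @^-1` B `&` E) = P (X @^-1` A) * P (Y @^-1` B) * P E) ->
  forall C : set (R * R), measurable C ->
    P ((fun w => (X w, Y w)) @^-1` C `&` E) =
    (distribution P X \x distribution P Y) C * P E.
Proof.
move=> mE XYE.
have mXY : measurable_fun setT (fun w => (X w, Y w)) by exact: measurable_fun_pair.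
pose m1 := measure_function_pushforward__canonical__measure_function_Measure
  (mrestr P mE) mXY.
have q0 : (0 <= fine (P E))%R by rewrite fine_ge0.
pose m2 := mscale (NngNum q0) (distribution P X \x distribution P Y).
move=> C mC.
suff : m1 C = m2 C by rewrite /m1/= /pushforward/= /mrestr /m2 /mscale/= fineK ?fin_num_measure// muleC.
apply: (measure_unique [set A `*` B | A in measurable & B in measurable] (fun=> setT)).
- by rewrite -measurable_prod_measurableType.
- move=> _ _ [A mA [B mB <-]] [A' mA' [B' mB' <-]].
  exists (A `&` A'); first exact: measurableI.
  by exists (B `&` B'); [exact: measurableI|rewrite setXI].
- by move=> _; exists setT => //; exists setT => //; rewrite setXTT.
- by rewrite bigcup_const//; exists 0%N.
- move=> _ [A mA [B mB <-]].
  rewrite /m1/= /pushforward/= /mrestr /m2 /mscale/= product_measure1E//.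
  by rewrite fineK ?fin_num_measure// muleC -XYE.
- move=> _; rewrite /m1/= /pushforward/= /mrestr.
  apply: (@le_lt_trans _ _ 1); last exact: ltry.
  by apply: probability_le1; rewrite preimage_setT setTI.
- exact: mC.
Qed.

(* [normal_prob] lives on [measurableTypeR R], whose display differs from that
   of [R]. *)
Lemma integral_has_law (X : {RV P >-> R}) (m s : R) (f : R -> \bar R) :
  has_law X (normal_prob m s) ->
  measurable_fun setT f -> (forall x, 0 <= f x) ->
  \int[distribution P X]_x f x = \int[normal_prob m s]_x f x.
Proof.
move=> lawX mf f0.
pose idR : measurableTypeR R -> R := idfun.
have mid : measurable_fun setT idR by move=> _ A mA; rewrite setTI.
transitivity (\int[measure_function_pushforward__canonical__measure_function_Measure (normal_prob m s) mid]_x f x).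
  by apply: eq_measure_integral => A mA _; exact: lawX.
by rewrite ge0_integral_pushforward.
Qed.

Definition lincomb (W : nat -> {RV P >-> R}) (a : nat -> R) (k : nat) (w : T) : R :=
  (\sum_(j < k) a j * W j w)%R.

Lemma measurable_lincomb W a k : measurable_fun setT (lincomb W a k).
Proof. by apply: measurable_sum => j; exact: measurable_funM. Qed.

HB.instance Definition _ W a k :=
  isMeasurableFun.Build _ _ T R (lincomb W a k) (measurable_lincomb W a k).

Definition lincomb_RV W a k : {RV P >-> R} := lincomb W a k.

Variable W : nat -> {RV P >-> R}.
Hypothesis indW : mutually_independent W.

Let tail (J : {fset nat}) (B : nat -> set R) := \bigcap_(j in [set` J]) (W j @^-1` B j).

Let measurable_tail J B : (forall j, measurable (B j)) -> measurable (tail J B).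
Proof.
by move=> mB; apply: bigcap_measurableType => // j _; exact: measurable_funPTI.
Qed.

(** All families of later indices are treated at once, because the induction step moves the index
    [k] from the sum into the family [J]. *)
Lemma lincomb_indep a k (J : {fset nat}) (B : nat -> set R) (A : set R) :
  (forall j, measurable (B j)) -> (forall j, j \in J -> (k <= j)%N) -> measurable A ->
  P (lincomb W a k @^-1` A `&` tail J B) = P (lincomb W a k @^-1` A) * P (tail J B).
Proof.
elim: k J B A => [|k IH] J B A mB kJ mA.
  have [A0|A0] := pselect (A 0%R).
    have -> : lincomb W a 0 @^-1` A = setT.
      by apply/seteqP; split => // w _; rewrite /= /lincomb big_ord0.
    by rewrite setTI probability_setT mul1e.
  have -> : lincomb W a 0 @^-1` A = set0.
    by apply/seteqP; split => // w; rewrite /= /lincomb big_ord0.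
  by rewrite set0I measure0 mul0e.
have key (J' : {fset nat}) : (forall j, j \in J' -> (k < j)%N) ->
  forall C : set (R * R), measurable C ->
    P ((fun w => (lincomb W a k w, W k w)) @^-1` C `&` tail J' B) =
    (distribution P (lincomb_RV W a k) \x distribution P (W k)) C * P (tail J' B).
  move=> kJ'; apply: joint_law; first exact: measurable_tail.
  move=> A' B' mA' mB'.
  (* The condition on [W k] joins the family as its entry at [k]. *)
  pose B2 j := if j == k then B' else B j.
  have mB2 j : measurable (B2 j) by rewrite /B2; case: ifP.
  have kJ'F : k \notin J' by apply/negP => /kJ'; rewrite ltnn.
  have BE j : j \in J' -> B2 j = B j.
    by move=> jJ; rewrite /B2; case: eqP => // jk; move: kJ'F; rewrite -jk jJ.
  have tE : tail J' B = tail J' B2.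
    by apply: eq_bigcapr => j; rewrite /= => /BE ->.
  have -> : W k @^-1` B' = tail [fset k]%fset B2.
    apply/seteqP; split => w; rewrite /tail/= => h.
      by move=> j; rewrite /= inE => /eqP ->; rewrite /B2 eqxx.
    by have := h k; rewrite /= inE eqxx /B2 eqxx; exact.
  rewrite tE -setIA.
  have -> : tail [fset k]%fset B2 `&` tail J' B2 = tail (k |` J')%fset B2.
    apply/seteqP; split => w; rewrite /tail/=.
      by move=> [h1 h2] j /=; rewrite in_fset1U => /orP[/eqP -> |jJ]; [apply: h1; rewrite /= inE|exact: h2].
    by move=> h; split => j /= jJ; apply: h => /=; rewrite in_fset1U ?jJ ?orbT//; move: jJ; rewrite inE => ->.
  rewrite (IH _ B2 A')//; last first.
    by move=> j; rewrite in_fset1U => /orP[/eqP ->//|/kJ' /ltnW].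
  rewrite -muleA; congr (_ * _).
  rewrite !indW// big_fsetU1//=; congr (_ * _).
  by rewrite big_seq_fset1.
pose C : set (R * R) := [set z | A (z.1 + a k * z.2)%R].
have mC : measurable C.
  rewrite -[C]setTI; have : measurable_fun setT (fun z : R * R => z.1 + a k * z.2)%R.
    by apply: measurable_funD => //; exact: measurable_funM.
  exact.
have SE : lincomb W a k.+1 @^-1` A = (fun w => (lincomb W a k w, W k w)) @^-1` C.
  by apply/seteqP; split => w; rewrite /C /= /lincomb big_ord_recr.
rewrite SE key//.
(* The empty family gives the law of the pair itself, which turns the factor into the probability
   for the longer sum. *)
have := key fset0 _ C mC.
have -> : tail fset0 B = setT by apply/seteqP; split => // w _ j.
by rewrite setIT probability_setT mule1 => <-.
Qed.

Lemma lincomb_cdf (sigma : R) (a : nat -> R) : (0 < sigma)%R ->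
  (forall j, (0 <= a j)%R) ->
  (forall j, has_law (W j) (normal_prob 0 sigma)) ->
  forall k x, P (lincomb W a k @^-1` `]-oo, x]) =
    (gcdf (sigma ^+ 2 * \sum_(j < k) a j ^+ 2) x)%:E.
Proof.
move=> s0 a0 lawW; elim => [|k IH] x.
  rewrite big_ord0 mulr0 /gcdf ltxx.
  have [x0|x0] := leP 0%R x.
    rewrite [X in P X](_ : _ = setT) ?probability_setT//.
    by apply/seteqP; split => // w _; rewrite /= /lincomb big_ord0 in_itv.
  rewrite [X in P X](_ : _ = set0) ?measure0//.
  by apply/seteqP; split => // w; rewrite /= /lincomb big_ord0 in_itv/= leNgt x0.
pose C : set (R * R) := [set z | (z.1 + a k * z.2 <= x)%R].
have mC : measurable C.
  have : measurable_fun setT (fun z : R * R => z.1 + a k * z.2)%R.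
    by apply: measurable_funD => //; exact: measurable_funM.
  move=> /(_ measurableT `]-oo, x]%classic (measurable_itv _)); rewrite setTI.
  by congr measurable; apply/seteqP; split => z; rewrite /= in_itv.
have SE : lincomb W a k.+1 @^-1` `]-oo, x] = (fun w => (lincomb W a k w, W k w)) @^-1` C `&` setT.
  by rewrite setIT; apply/seteqP; split => w; rewrite /C /= in_itv/= /lincomb big_ord_recr.
rewrite SE (@joint_law (lincomb_RV W a k) (W k))//; last first.
  move=> A B mA mB; rewrite setIT probability_setT mule1.
  have := @lincomb_indep a k [fset k]%fset (fun=> B) A (fun=> mB).
  have -> : tail [fset k]%fset (fun=> B) = W k @^-1` B.
    apply/seteqP; split => w; rewrite /tail/= => h.
      by apply: h; rewrite /= inE.
    by move=> j; rewrite /= inE => /eqP ->.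
  by apply => // j; rewrite inE => /eqP ->.
rewrite probability_setT mule1.
(* Integrating over [W k] last makes each section at [w] the event that the partial sum is at most
   [x - a k * w], to which the induction hypothesis applies. *)
rewrite (product_measure_unique (m' := distribution P (lincomb_RV W a k) \x^ distribution P (W k)))//; last first.
  by move=> A B mA mB; exact: product_measure2E.
rewrite /= /product_measure2 big_ord_recr/= mulrDr.
rewrite -gcdf_conv//; last by rewrite mulr_ge0 ?sqr_ge0// sumr_ge0// => j _; exact: sqr_ge0.
have mf : measurable_fun setT (fun w => distribution P (lincomb_RV W a k) (ysection C w)).
  exact: measurable_fun_ysection.
rewrite (integral_has_law (lawW k))//.
apply: eq_integral => w _; rewrite -IH /=; congr (P _).
by apply/seteqP; split => t; rewrite /= /ysection/= inE /C/= in_itv/= lerBrDr.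
Qed.

End independent_sums.

(** * Conditioning on a finite arrival pattern *)

Section gaussian_mixture.
Context {R : realType} d (T : measurableType d) (P : probability T R).
Local Open Scope ereal_scope.

Lemma sigma_seq_measurable (X : nat -> {RV P >-> R}) A :
  sigma_seq X A -> measurable A.
Proof.
move=> XA; apply: (smallest_sub _ _ XA); first exact: sigma_algebra_measurable.
by move=> _ [j _ [B mB <-]]; rewrite setTI; exact: measurable_funPTI.
Qed.

(** Viewed as the measurable sets of [g_sigma_algebraType (gen X)], the events of [sigma_seq X]
    inherit the closure properties of measurable functions. *)
Let gen (X : nat -> {RV P >-> R}) := \bigcup_j preimage_set_system setT (X j) measurable.

Let measurable_gen (X : nat -> {RV P >-> R}) j :
  measurable_fun setT (X j : g_sigma_algebraType (gen X) -> R).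
Proof.
by move=> _ A mA; apply: sub_sigma_algebra; exists j => //; exists A.
Qed.

Lemma sigma_seq_preimage (X : nat -> {RV P >-> R}) j A : measurable A ->
  sigma_seq X (X j @^-1` A).
Proof.
by move=> mA; rewrite -[_ @^-1` _]setTI; exact: (@measurable_gen X j measurableT A mA).
Qed.

Lemma sigma_seq_bigcap (X : nat -> {RV P >-> R}) (I : finType) (D : I -> set T) :
  (forall i, sigma_seq X (D i)) -> sigma_seq X (\bigcap_i D i).
Proof.
move=> XD.
suff : @measurable _ (g_sigma_algebraType (gen X)) (\bigcap_i D i) by [].
by apply: fin_bigcap_measurable => // i _; exact: XD.
Qed.

Lemma sigma_seq_lincomb (X : nat -> {RV P >-> R}) a n A : measurable A ->
  sigma_seq X (lincomb X a n @^-1` A).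
Proof.
move=> mA; rewrite -[_ @^-1` _]setTI.
have : measurable_fun setT (lincomb X a n : g_sigma_algebraType (gen X) -> R).
  by apply: measurable_sum => j; apply: measurable_funM => //; exact: measurable_gen.
exact.
Qed.

Variables (W Gam : nat -> {RV P >-> R}) (sigma : R).
Hypotheses (sigma0 : (0 < sigma)%R) (indW : mutually_independent W)
  (lawW : forall j, has_law (W j) (normal_prob 0 sigma))
  (indWG : independent_seq W Gam).

(** On each event [X = i] the coefficients are constants and the event is independent of [W], so
    summing [lincomb_cdf] over [i] replaces a conditional expectation. *)
Lemma gaussian_mixture (I : finType) (X : T -> I) (b : I -> nat -> R) n x :
  (forall i, sigma_seq Gam (X @^-1` [set i])) -> (forall i j, (0 <= b i j)%R) ->
  P [set w | (lincomb W (b (X w)) n w <= x)%R] =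
  \int[P]_w (gcdf (sigma ^+ 2 * \sum_(j < n) b (X w) j ^+ 2) x)%:E.
Proof.
move=> XG b0.
have mX i : measurable (X @^-1` [set i]) by exact: sigma_seq_measurable (XG i).
pose S i := lincomb W (b i) n @^-1` `]-oo, x].
have mS i : measurable (S i) by apply: sigma_seq_measurable; exact: sigma_seq_lincomb.
have mSX i : measurable (S i `&` X @^-1` [set i]) by exact: measurableI.
have sumX (f : I -> T -> \bar R) w :
    (\sum_i f i w * (\1_(X @^-1` [set i]) w)%:E) = f (X w) w.
  rewrite (bigD1 (X w))//= indicE mem_set// mule1 big1 ?adde0// => i iX.
  by rewrite indicE memNset ?mule0// => /= Xi; rewrite Xi eqxx in iX.
transitivity (\int[P]_w (\sum_i (\1_(S i `&` X @^-1` [set i]) w)%:E)).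
  have mA : measurable [set w | (lincomb W (b (X w)) n w <= x)%R].
    rewrite (_ : [set w | _] = \bigcup_i (S i `&` X @^-1` [set i])).
      by apply: fin_bigcup_measurable.
    apply/seteqP; split => w /=; first by move=> h; exists (X w) => //; split => //; rewrite /S/= in_itv.
    by move=> [i _ [h /= Xi]]; move: h; rewrite Xi /S/= in_itv.
  rewrite -[X in P X](setIT _) -integral_indic//; apply: eq_integral => w _.
  have := sumX (fun i w => (\1_(S i) w)%:E) w.
  under eq_bigr do rewrite -EFinM -[(_ * _)%R]/((\1_(S _) \* \1_(X @^-1` [set _]))%R w) -indicI.
  move=> ->; rewrite !indicE; congr (_%:R%:E).
rewrite ge0_integral_sum//; last first.
  by move=> i; apply/measurable_EFinP; exact: measurable_indic.
transitivity (\sum_i \int[P]_w ((gcdf (sigma ^+ 2 * \sum_(j < n) b i j ^+ 2) x)%:E * (\1_(X @^-1` [set i]) w)%:E)).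
  apply: eq_bigr => i _.
  rewrite integral_indic// setIT ge0_integralZl//; last 2 first.
  - by apply/measurable_EFinP; exact: measurable_indic.
  - by rewrite lee_fin gcdf_ge0.
  rewrite integral_indic// setIT -(lincomb_cdf indW sigma0 (b0 i) lawW).
  by apply: indWG => //; exact: sigma_seq_lincomb.
rewrite -ge0_integral_sum//; last 2 first.
- by move=> i; apply: emeasurable_funM => //; apply/measurable_EFinP; exact: measurable_indic.
- by move=> i w _; rewrite mule_ge0// lee_fin// gcdf_ge0.
apply: eq_integral => w _.
exact: (sumX (fun i _ => (gcdf (sigma ^+ 2 * \sum_(j < n) b i j ^+ 2) x)%:E)).
Qed.

Definition step (k : nat) (t b : nat -> R) (u : R) : R :=
  (\sum_(i < k) b i * (t i < u <= t i.+1)%R%:R)%R.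

Lemma gaussian_mixture_step n k (t b : nat -> R) x : (forall i, (0 <= b i)%R) ->
  P [set w | (\sum_(j < n) W j w * step k t b (Gam j w) <= x)%R] =
  \int[P]_w (gcdf (sigma ^+ 2 * \sum_(j < n) step k t b (Gam j w) ^+ 2) x)%:E.
Proof.
move=> b0.
(* The pattern records which of the first [n] arrivals falls in which of the [k] cells; it
   determines all coefficients. *)
pose X w : {ffun 'I_n * 'I_k -> bool} := [ffun p : 'I_n * 'I_k => (t p.2 < Gam p.1 w <= t p.2.+1)%R].
(* Coefficients are indexed by all of [nat]; those at [j >= n] get the default 0 and never enter the
   sum. *)
pose B (f : {ffun 'I_n * 'I_k -> bool}) (j : nat) : R :=
  if insub j is Some j' then (\sum_(i < k) b i * (f (j', i))%:R)%R else 0%R.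
have BE w (j : 'I_n) : B (X w) j = step k t b (Gam j w).
  by rewrite /B valK; apply: eq_bigr => i _; rewrite ffunE.
have := @gaussian_mixture _ X B n x.
under eq_integral do under eq_bigr do rewrite BE.
move=> <-.
- congr (P _); apply/seteqP; split => w /=; rewrite /lincomb; 
  by under eq_bigr do rewrite mulrC -BE.
- move=> f; rewrite (_ : _ @^-1` _ = \bigcap_(p : 'I_n * 'I_k)
     (Gam p.1 @^-1` [set u | (t p.2 < u <= t p.2.+1)%R = f p])).
    apply: sigma_seq_bigcap => p; apply: sigma_seq_preimage.
    case: (f p).
      by rewrite (_ : [set u | _] = `]t p.2, t p.2.+1]%classic).
    rewrite (_ : [set u | _] = ~` `]t p.2, t p.2.+1]%classic); first exact: measurableC.
    by apply/seteqP; split => u /=; rewrite in_itv/=; case: (_ && _) => // /(_ isT).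
  apply/seteqP; split => w /=; first by move=> <- q _ /=; rewrite ffunE.
  by move=> h; apply/ffunP => q; rewrite ffunE; exact: h.
- move=> f j; rewrite /B; case: insubP => //= j' _ _.
  by apply: sumr_ge0 => i _; rewrite mulr_ge0.
Qed.

End gaussian_mixture.

(** * Counting the arrivals *)

Section poisson_moments.
Context {R : realType}.
Implicit Types (lam : R).
Local Open Scope ereal_scope.

Lemma poisson_pmf_sum lam : (0 < lam)%R ->
  \sum_(0 <= k <oo) (poisson_pmf lam k)%:E = 1.
Proof.
move=> lam0; have := @probability_setT _ _ _ (poisson_prob lam 0%N : probability _ _).
rewrite /= /poisson_prob lam0 => <-.
by rewrite nneseries_esumT// => k; rewrite lee_fin poisson_pmf_ge0.
Qed.

(** Shifting the index by this identity lowers the degree of a moment by one. *)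
Lemma poisson_pmfS lam k : (0 < lam)%R ->
  (k.+1%:R * poisson_pmf lam k.+1 = lam * poisson_pmf lam k)%R.
Proof.
move=> lam0; rewrite /poisson_pmf lam0 factS natrM exprS.
have f0 : (k`!%:R != 0 :> R)%R by rewrite pnatr_eq0 -lt0n fact_gt0.
have k0 : (k.+1%:R != 0 :> R)%R by rewrite pnatr_eq0.
by rewrite invfM; set x := expR _; field; rewrite f0 addrC natr1 k0.
Qed.

Lemma poisson_mean lam : (0 < lam)%R ->
  \sum_(0 <= k <oo) (k%:R * poisson_pmf lam k)%:E = lam%:E.
Proof.
move=> lam0; rewrite nneseries_recl//; last first.
  by move=> k; rewrite lee_fin mulr_ge0// poisson_pmf_ge0.
rewrite mul0r add0e -nneseries_addn; last first.
  by move=> k; rewrite lee_fin mulr_ge0// poisson_pmf_ge0.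
under eq_eseriesr do rewrite addn1 poisson_pmfS// EFinM.
rewrite nneseriesZl//; last by move=> k _; rewrite lee_fin poisson_pmf_ge0.
by rewrite poisson_pmf_sum// mule1.
Qed.

Lemma poisson_second_moment lam : (0 < lam)%R ->
  \sum_(0 <= k <oo) (k%:R ^+ 2 * poisson_pmf lam k)%:E = (lam + lam ^+ 2)%:E.
Proof.
move=> lam0; rewrite nneseries_recl//; last first.
  by move=> k; rewrite lee_fin mulr_ge0// ?sqr_ge0// poisson_pmf_ge0.
rewrite expr0n mul0r add0e -nneseries_addn; last first.
  by move=> k; rewrite lee_fin mulr_ge0// ?sqr_ge0// poisson_pmf_ge0.
under eq_eseriesr.
  move=> k _; rewrite addn1 expr2 -mulrA poisson_pmfS// mulrCA EFinM.
  rewrite -natr1 mulrDl mul1r EFinD; over.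
rewrite nneseriesZl//; last first.
  by move=> k _; rewrite adde_ge0// lee_fin ?mulr_ge0// poisson_pmf_ge0.
rewrite nneseriesD//; last 2 first.
- by move=> k _; rewrite lee_fin mulr_ge0// poisson_pmf_ge0.
- by move=> k _; rewrite lee_fin poisson_pmf_ge0.
by rewrite poisson_mean// poisson_pmf_sum// -EFinD -EFinM mulrDr mulr1 addrC expr2.
Qed.

Lemma probability_bigcup_poisson d (T : measurableType d) (P : probability T R) lam
    (A : nat -> set T) :
  (0 < lam)%R -> (forall k, measurable (A k)) -> trivIset setT A ->
  (forall k, P (A k) = (poisson_pmf lam k)%:E) -> P (\bigcup_k A k) = 1.
Proof.
move=> lam0 mA tA PA; rewrite measure_bigcup// -(poisson_pmf_sum lam0).
rewrite (@eq_eseriesl _ _ xpredT); last by move=> k; rewrite in_setT.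
by apply: eq_eseriesr => k _; exact: PA.
Qed.

Lemma probability_setI1 d (T : measurableType d) (P : probability T R) (A G : set T) :
  measurable A -> measurable G -> P G = 1 -> P (A `&` G) = P A.
Proof.
move=> mA mG PG; rewrite [RHS](measureDI P mA mG) [X in X + _](_ : _ = 0) ?add0e//.
apply/eqP; rewrite -measure_le0; apply: (@le_trans _ _ (P (~` G))).
  apply: le_measure; rewrite ?inE; [exact: measurableD|exact: measurableC|by move=> w []].
by rewrite probability_setC// PG subee.
Qed.

Lemma integral_poisson d (T : measurableType d) (P : probability T R) lam
    (A : nat -> set T) (f : T -> \bar R) (v : nat -> R) :
  (0 < lam)%R -> (forall k, measurable (A k)) -> trivIset setT A ->
  (forall k, P (A k) = (poisson_pmf lam k)%:E) ->
  measurable_fun setT f -> (forall w, 0 <= f w) -> (forall k, (0 <= v k)%R) ->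
  (forall k w, A k w -> f w = (v k)%:E) ->
  \int[P]_w f w = \sum_(0 <= k <oo) (v k * poisson_pmf lam k)%:E.
Proof.
move=> lam0 mA tA PA mf f0 v0 fv.
have mUA : measurable (\bigcup_k A k) by exact: bigcup_measurable.
have PUA : P (\bigcup_k A k) = 1 by exact: (probability_bigcup_poisson lam0).
have PCA : P (~` \bigcup_k A k) = 0 by rewrite probability_setC// PUA subee.
rewrite -(setUv (\bigcup_k A k)) ge0_integral_setU//=; last 3 first.
- exact: measurableC.
- by rewrite setUv.
- by rewrite disj_set2E setICr.
rewrite [X in _ + X]null_set_integral ?adde0//; last 2 first.
- exact: measurableC.
- exact: measurable_funTS.
rewrite ge0_integral_bigcup//; last exact: measurable_funTS.
apply: eq_eseriesr => k _; rewrite (eq_integral (cst (v k)%:E)).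
  by rewrite integral_cst//= EFinM; congr (_ * _); exact: PA.
by move=> w; rewrite inE => /fv.
Qed.

End poisson_moments.

Section counting_process.
Context {R : realType} d (T : measurableType d) (P : probability T R).
Variables (Gam : nat -> {RV P >-> R}).
Implicit Types (c s t u : R).
Local Open Scope ereal_scope.

Definition hits s t (w : T) : set nat := [set j | (s < Gam j w <= t)%R].

Lemma measurable_counting_hits s t :
  measurable_fun setT (fun w => counting (hits s t w) : \bar R).
Proof.
under eq_fun do rewrite counting_dirac.
apply: ge0_emeasurable_sum => // j _.
rewrite (_ : (fun w => _) = (fun w => (\1_`]s, t] (Gam j w))%:E)).
  by apply/measurable_EFinP; apply: (measurableT_comp (measurable_indic _)).
apply/funext => w; rewrite /dirac !indicE; congr (_%:R%:E).
Qed.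

(** Trades cardinalities for [counting], a series of Dirac masses and hence measurable in [w]. *)
Lemma arrivals_eqE s t k :
  arrivals_eq Gam s t k = [set w | counting (hits s t w) = k%:R%:E :> \bar R].
Proof.
apply/seteqP; split => w; rewrite /arrivals_eq/= -/(hits s t w).
  move=> h; rewrite /counting asboolT; last by exists k.
  congr (_%:R%:E); apply/esym/eqP; rewrite eq_sym; apply/eqP/card_eq_fsetP.
  by rewrite fset_setK//; exists k.
rewrite /counting; case: asboolP => // fin [] /eqP.
by rewrite eqr_nat => /eqP /card_eq_fsetP; rewrite fset_setK.
Qed.

Lemma measurable_arrivals_eq s t k : measurable (arrivals_eq Gam s t k).
Proof.
rewrite arrivals_eqE.
have := measurable_counting_hits s t.
move=> /(_ measurableT [set k%:R%:E]); rewrite setTI; apply.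
exact: emeasurable_set1.
Qed.

Lemma trivIset_arrivals_eq s t : trivIset setT (arrivals_eq Gam s t).
Proof.
apply/trivIsetP => i j _ _ ij; apply/seteqP; split => // w.
by rewrite !arrivals_eqE => -[/= -> [/eqP]]; rewrite eqr_nat (negbTE ij).
Qed.

Lemma measurable_lty_counting s t :
  measurable [set w | counting (hits s t w) < +oo :> \bar R].
Proof.
rewrite (_ : [set w | _] = ~` ((fun w => counting (hits s t w) : \bar R) @^-1` [set +oo])).
  apply: measurableC; rewrite -[X in measurable X]setTI.
  exact: measurable_counting_hits (emeasurable_set1 _).
by apply/seteqP; split => w; rewrite /= ltey => /eqP.
Qed.

Lemma counting_hitsD c s t w : (c <= s)%R -> (s <= t)%R ->
  counting (hits c t w) = counting (hits c s w) + counting (hits s t w) :> \bar R.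
Proof.
move=> cs st; rewrite -measureU//; last first.
  apply/seteqP; split => // j; rewrite /hits/= => -[/andP[_ js] /andP[sj _]].
  by move: sj; rewrite ltNge js.
congr counting; apply/seteqP; split => j; rewrite /hits/=.
  by case: (leP (Gam j w) s) => [js /andP[-> _]|sj /andP[_ ->]]; [left|right].
by move=> [/andP[-> /le_trans->//]|/andP[/(le_lt_trans cs) -> ->]].
Qed.

(** Takes the value 0 when there are infinitely many points in the interval. *)
Definition arrivals c t (w : T) : R := fine (counting (hits c t w)).

Lemma measurable_arrivals c t : measurable_fun setT (arrivals c t).
Proof.
by apply: (measurableT_comp (fine_measurable measurableT)) => //; exact: measurable_counting_hits.
Qed.

Hypothesis poissonG : forall s t k, (0 <= s)%R -> (s < t)%R ->
  P (arrivals_eq Gam s t k) = (poisson_pmf (t - s) k)%:E.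

Lemma counting_hits_lty c s : (0 <= c)%R -> (c <= s)%R ->
  P [set w | counting (hits c s w) < +oo :> \bar R] = 1.
Proof.
move=> c0; rewrite le_eqVlt => /predU1P[<-|cs].
  rewrite -(@probability_setT _ _ _ P); congr (P _); apply/seteqP; split => // w _ /=.
  rewrite (_ : hits c c w = set0) ?measure0//.
  by apply/seteqP; split => // j /andP[cj]; rewrite leNgt cj.
apply/eqP; rewrite eq_le probability_le1/=; last exact: measurable_lty_counting.
have cs0 : (0 < s - c)%R by rewrite subr_gt0.
have mU : measurable (\bigcup_k arrivals_eq Gam c s k).
  by apply: bigcup_measurable => k _; exact: measurable_arrivals_eq.
rewrite -(probability_bigcup_poisson (P := P) cs0 (measurable_arrivals_eq c s)
  (@trivIset_arrivals_eq c s)) => [|k]; last exact: poissonG.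
apply: le_measure; rewrite ?inE//; first exact: measurable_lty_counting.
by move=> w [k _]; rewrite arrivals_eqE/= => ->; rewrite ltry.
Qed.

Lemma integral_incr c s t (f : R -> \bar R) : (0 <= c)%R -> (c <= s)%R -> (s < t)%R ->
  measurable_fun setT f -> (forall x, 0 <= f x) -> (forall k : nat, f k%:R \is a fin_num) ->
  \int[P]_w f (arrivals c t w - arrivals c s w)%R =
  \sum_(0 <= k <oo) (fine (f k%:R) * poisson_pmf (t - s) k)%:E.
Proof.
move=> c0 cs st mf f0 ffin.
have st0 : (0 < t - s)%R by rewrite subr_gt0.
pose G := [set w | counting (hits c s w) < +oo :> \bar R].
have mG : measurable G by exact: measurable_lty_counting.
have PG : P G = 1 by exact: counting_hits_lty.
(* Finiteness of the count in ]c, s] is required for [fine] to be additive; intersecting with [G]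
   does not change probabilities. *)
pose A k := arrivals_eq Gam s t k `&` G.
have mA k : measurable (A k) by apply: measurableI => //; exact: measurable_arrivals_eq.
apply: (integral_poisson st0 mA).
- exact: trivIset_setIr (@trivIset_arrivals_eq s t).
- move=> k; rewrite -poissonG//; last exact: le_trans cs.
  by apply: probability_setI1 => //; exact: measurable_arrivals_eq.
- apply: (measurableT_comp mf).
  by apply: measurable_funB; exact: measurable_arrivals.
- by move=> w; exact: f0.
- by move=> k; rewrite fine_ge0.
- move=> k w; rewrite /A arrivals_eqE => -[/= Ak Gw].
  rewrite fineK//; congr f.
  rewrite /arrivals (counting_hitsD w cs (ltW st)) Ak fineD//; last by rewrite ge0_fin_numE.
  by rewrite addrC addKr.
Qed.

End counting_process.

Section counting_moments.
Context {R : realType} d (T : measurableType d) (P : probability T R).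
Implicit Types (c s t u : R).
Local Open Scope ereal_scope.

Lemma Lfun2_sqr (f : T -> R) : measurable_fun setT f ->
  \int[P]_w ((f w) ^+ 2)%:E < +oo -> f \in Lfun P 2%:E.
Proof.
move=> mf f2; apply/andP; split; rewrite inE//=.
rewrite /finite_norm unlock/= ?pnatr_eq0/=; apply: poweR_lty.
rewrite (eq_integral (fun w => (f w ^+ 2)%:E))// => w _.
by rewrite powR_mulrn// real_normK ?num_real.
Qed.

Variables (Gam : nat -> {RV P >-> R}).
Hypothesis poissonG : forall s t k, (0 <= s)%R -> (s < t)%R ->
  P (arrivals_eq Gam s t k) = (poisson_pmf (t - s) k)%:E.
Variable c : R.
Hypothesis c0 : (0 <= c)%R.

(** A difference of counts from the common origin [c], rather than a count in ]s, t]: increments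
    over adjacent intervals then add up at every point, even where a count is infinite. *)
Definition incr s t : T -> R := (arrivals Gam c t \- arrivals Gam c s)%R.

Lemma measurable_incr s t : measurable_fun setT (incr s t).
Proof. by apply: measurable_funB; exact: measurable_arrivals. Qed.

Let integral_incr_sqr s t : (c <= s)%R -> (s < t)%R ->
  \int[P]_w ((incr s t w) ^+ 2)%:E = ((t - s) + (t - s) ^+ 2)%:E.
Proof.
move=> cs st; rewrite -poisson_second_moment ?subr_gt0//.
rewrite (integral_incr poissonG (f := fun x => (x ^+ 2)%:E))//.
- by apply/measurable_EFinP; exact: measurable_funX.
- by move=> x; rewrite lee_fin sqr_ge0.
Qed.

Lemma incr_Lfun2 s t : (c <= s)%R -> (s <= t)%R -> incr s t \in Lfun P 2%:E.
Proof.
move=> cs; rewrite le_eqVlt => /predU1P[<-|st].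
  rewrite (_ : incr s s = cst 0%R); first exact: Lfun_cst.
  by apply/funext => w; rewrite /incr/= subrr.
by apply: Lfun2_sqr; [exact: measurable_incr|rewrite integral_incr_sqr// ltry].
Qed.

Lemma Lfun21 (f : T -> R) : f \in Lfun P 2%:E -> f \in Lfun P 1.
Proof. by apply: Lfun_subset12; exact: fin_num_measure. Qed.

Lemma expectation_incr s t : (c <= s)%R -> (s <= t)%R ->
  'E_P[incr s t] = (t - s)%:E.
Proof.
move=> cs; rewrite le_eqVlt => /predU1P[<-|st].
  rewrite (_ : incr s s = cst 0%R) ?expectation_cst ?subrr//.
  by apply/funext => w; rewrite /incr/= subrr.
have st0 : (0 < t - s)%R by rewrite subr_gt0.
(* The Poisson sums evaluate integrals of nonnegative functions, but [incr] may be negative on a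
   null set. The mean is therefore read off from those of [|incr|] and of [|incr| - incr]. *)
have cnt1 : \int[P]_w (`|incr s t w|)%:E = (t - s)%:E.
  rewrite (integral_incr poissonG (f := fun x => `|x|%:E))//.
    rewrite -[RHS]poisson_mean//; apply: eq_eseriesr => k _ /=.
    by rewrite ger0_norm.
  by apply/measurable_EFinP; exact: normr_measurable.
have cnt2 : \int[P]_w (`|incr s t w| - incr s t w)%:E = 0.
  rewrite (integral_incr poissonG (f := fun x => (`|x| - x)%:E))//.
  - by rewrite eseries0// => k _ _; rewrite /= ger0_norm// subrr mul0r.
  - by apply/measurable_EFinP; apply: measurable_funB => //; exact: normr_measurable.
  - by move=> x; rewrite lee_fin subr_ge0 ler_norm.
have L1 := Lfun21 (incr_Lfun2 cs (ltW st)).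
have nL1 : (fun w => `|incr s t w|)%R \in Lfun P 1 by exact: Lfun_norm.
have := @expectationB _ _ _ P _ _ nL1 L1.
rewrite (_ : 'E_P[(fun w : T => `|incr s t w|)%R] = (t - s)%:E); last by rewrite unlock cnt1.
rewrite (_ : 'E_P[_ \- incr s t] = 0); last by rewrite unlock.
by rewrite -(fineK (expectation_fin_num L1)) -EFinB => -[] h; congr EFin; lra.
Qed.

Lemma variance_incr s t : (c <= s)%R -> (s <= t)%R ->
  'V_P[incr s t] = (t - s)%:E.
Proof.
move=> cs st; rewrite varianceE ?incr_Lfun2// expectation_incr//.
move: st; rewrite le_eqVlt => /predU1P[<-|st].
  rewrite (_ : incr s s = cst 0%R); last by apply/funext => w; rewrite /incr/= subrr.
  rewrite (_ : (cst 0 ^+ 2)%R = cst 0%R :> (T -> R)); last by apply/funext => w; rewrite /= !fctE expr0n.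
  by rewrite expectation_cst subrr expe2 mule0 sube0.
rewrite unlock integral_incr_sqr// expe2 -EFinM -EFinB -expr2.
by rewrite addrK.
Qed.

(* The counts in adjacent intervals and in their union are all Poisson, so that
   the variances add up; polarization then gives the covariance. *)
Lemma covariance_incr s t u v : (c <= s)%R -> (s <= t)%R -> (t <= u)%R -> (u <= v)%R ->
  covariance P (incr s t) (incr u v) = 0.
Proof.
move=> cs st tu uv.
have [ct cu] : (c <= t /\ c <= u)%R.
  by have ct := le_trans cs st; split => //; exact: le_trans tu.
have [su tv] : (s <= u /\ t <= v)%R by split; [exact: le_trans tu|exact: le_trans uv].
have sv : (s <= v)%R by exact: le_trans tv.
have key a b x : (c <= a)%R -> (a <= b)%R -> (b <= x)%R ->
    (covariance P (incr a b) (incr b x) = 0).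
  move=> ca ab bx.
  have cb := le_trans ca ab.
  have ax := le_trans ab bx.
  have := @varianceD _ _ _ P _ _ (incr_Lfun2 ca ab) (incr_Lfun2 cb bx).
  rewrite (_ : (incr a b \+ incr b x)%R = incr a x); last first.
    by apply/funext => w; rewrite /incr/=; ring.
  rewrite !variance_incr//.
  have : covariance P (incr a b) (incr b x) \is a fin_num.
    by apply: covariance_fin_num; rewrite ?Lfun2_mul_Lfun1 ?Lfun21 ?incr_Lfun2.
  move/fineK => <-; set z := fine _.
  by rewrite -EFinM -!EFinD => -[] h; congr EFin; lra.
(* The covariances with the adjacent increments over ]t, u] and ]t, v] vanish, hence so does the one
   with their difference. *)
have := @covarianceDr _ _ _ P _ _ _ (incr_Lfun2 cs st) (incr_Lfun2 ct tu) (incr_Lfun2 cu uv).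
rewrite (_ : (incr t u \+ incr u v)%R = incr t v); last first.
  by apply/funext => w; rewrite /incr/=; ring.
by rewrite !key// add0e => <-.
Qed.

Variables (t b : nat -> R).
Hypotheses (t0 : t 0%N = c) (tS : forall i, (t i <= t i.+1)%R).

Let tge : {homo t : i j / (i <= j)%N >-> (i <= j)%R}.
Proof. by apply: (@homo_leq _ t <=%R) => //; exact: le_trans. Qed.

Let ct i : (c <= t i)%R.
Proof. by rewrite -t0; exact: tge. Qed.

Definition step_sum (k : nat) (w : T) : R :=
  (\sum_(i < k) b i * incr (t i) (t i.+1) w)%R.

Let step_sumS k : step_sum k.+1 = (step_sum k \+ b k \o* incr (t k) (t k.+1))%R.
Proof. by apply/funext => w; rewrite /step_sum big_ord_recr/= [(b k * _)%R]mulrC. Qed.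

Let step_sum0 : step_sum 0 = cst 0%R.
Proof. by apply/funext => w; rewrite /step_sum big_ord0. Qed.

Lemma step_sum_Lfun2 k : step_sum k \in Lfun P 2%:E.
Proof.
elim: k => [|k IH]; first by rewrite step_sum0 Lfun_cst.
rewrite step_sumS; apply: rpredD => [|H12|H12]; [by rewrite lee1n|exact: IH|].
by apply: Lfun_scale; [rewrite ler1n|exact: incr_Lfun2].
Qed.

Lemma expectation_step_sum k :
  'E_P[step_sum k] = (\sum_(i < k) b i * (t i.+1 - t i))%:E.
Proof.
elim: k => [|k IH]; first by rewrite step_sum0 expectation_cst big_ord0.
have L1 := Lfun21 (incr_Lfun2 (ct k) (tS k)).
rewrite step_sumS expectationD ?Lfun21 ?step_sum_Lfun2//; last by apply: Lfun_scale; [rewrite ler1n|exact: incr_Lfun2].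
by rewrite IH expectationZl// expectation_incr// big_ord_recr/= EFinD.
Qed.

Let covariance_step_sum k u v : (t k <= u)%R -> (u <= v)%R ->
  covariance P (step_sum k) (incr u v) = 0.
Proof.
elim: k => [|k IH] tku uv; first by rewrite step_sum0 covariance_cst_l.
have cu : (c <= u)%R by exact: le_trans tku.
have L2 := incr_Lfun2 (ct k) (tS k).
have L2' := incr_Lfun2 cu uv.
rewrite step_sumS covarianceDl ?step_sum_Lfun2//; last by apply: Lfun_scale; rewrite ?ler1n.
rewrite IH//; last exact: le_trans tku.
rewrite covarianceZl ?Lfun2_mul_Lfun1 ?Lfun21//.
by rewrite covariance_incr// mule0 adde0.
Qed.

Lemma variance_step_sum k :
  'V_P[step_sum k] = (\sum_(i < k) b i ^+ 2 * (t i.+1 - t i))%:E.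
Proof.
elim: k => [|k IH]; first by rewrite step_sum0 variance_cst big_ord0.
have L2 := incr_Lfun2 (ct k) (tS k).
rewrite step_sumS varianceD ?step_sum_Lfun2//; last by apply: Lfun_scale; rewrite ?ler1n.
rewrite covarianceZr ?Lfun2_mul_Lfun1 ?Lfun21 ?step_sum_Lfun2//.
rewrite covariance_step_sum// !mule0 adde0 IH varianceZ// variance_incr//.
by rewrite big_ord_recr/= EFinD.
Qed.

End counting_moments.

(** * The truncated series *)

Section measurable_gcdf.
Context {R : realType}.

(** Monotonicity in the variance suffices: nondecreasing for [y < 0], nonincreasing for [y >= 0]. *)
Lemma measurable_gcdf (y : R) : measurable_fun setT (gcdf ^~ y).
Proof.
have [y0|y0] := leP 0 y; last first.
  apply: nondecreasing_measurable => // v w vw; rewrite /gcdf (leNgt 0 y) y0/=.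
  case: ifPn => v0; case: ifPn => w0; rewrite ?Phi_ge0//.
    by apply: Phi_le; rewrite ler_wnM2l ?(ltW y0)// lef_pV2 ?posrE ?sqrtr_gt0 ?ler_wsqrtr.
  by rewrite (lt_le_trans v0 vw) in w0.
have -> : gcdf ^~ y = (fun v => - - gcdf v y) by apply/funext => v0; rewrite opprK.
apply: measurable_funN; apply: nondecreasing_measurable => // v w vw.
rewrite lerN2 /gcdf y0/=.
case: ifPn => v0; case: ifPn => w0; rewrite ?Phi_le1//.
  by apply: Phi_le; rewrite ler_wpM2l// lef_pV2 ?posrE ?sqrtr_gt0 ?ler_wsqrtr.
by rewrite (lt_le_trans w0 vw) in v0.
Qed.

End measurable_gcdf.

Section step_functions.
Context {R : realType}.
Variables (t b : nat -> R).
Hypothesis tS : forall i, t i <= t i.+1.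

Lemma measurable_step k : measurable_fun setT (step k t b).
Proof.
apply: measurable_sum => i; apply: measurable_funM => //.
rewrite (_ : (fun _ => _) = \1_`]t i, t i.+1]); first exact: measurable_indic.
by apply/funext => u; rewrite indicE mem_setE in_itv.
Qed.

Let tge : {homo t : i j / (i <= j)%N >-> i <= j}.
Proof. by apply: (@homo_leq _ t <=%R) => //; exact: le_trans. Qed.

Lemma step_gt k u : t k < u -> step k t b u = 0.
Proof.
move=> tku; apply: big1 => i _.
suff -> : (u <= t i.+1) = false by rewrite andbF mulr0.
by apply/negbTE; rewrite -ltNge; apply: le_lt_trans tku; apply: tge.
Qed.

Lemma step_sqr k u : step k t b u ^+ 2 = step k t (fun i => b i ^+ 2) u.
Proof.
elim: k => [|k IH]; first by rewrite /step !big_ord0 expr0n.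
have stepS b' : step k.+1 t b' u = step k t b' u + b' k * (t k < u <= t k.+1)%R%:R.
  by rewrite /step big_ord_recr.
rewrite !stepS; case: (boolP (t k < u <= t k.+1)) => [/andP[tku _]|_].
  by rewrite -IH step_gt// !mulr1 expr0n/= !add0r.
by rewrite !mulr0 !addr0 IH.
Qed.

End step_functions.

Lemma dist_le1 {R : realType} (x y : R) : y <= 1 -> 0 <= y -> x <= 1 -> 0 <= x -> `|y - x| <= 1.
Proof. by rewrite ler_norml => *; lra. Qed.

(** * Distance to the normal law for step functions *)

Section step_bound.
Context {R : realType} d (T : measurableType d) (P : probability T R).
Variables (W Gam : nat -> {RV P >-> R}) (sigma : R).
Hypotheses (sigma0 : (0 < sigma)%R) (indW : mutually_independent W)
  (lawW : forall j, has_law (W j) (normal_prob 0 sigma))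
  (indWG : independent_seq W Gam).
Hypothesis poissonG : forall s t k, 0 <= s -> s < t ->
  P (arrivals_eq Gam s t k) = (poisson_pmf (t - s) k)%:E.
Variables (t b : nat -> R) (k : nat).
Hypotheses (t0 : 0 <= t 0%N) (tS : forall i, t i <= t i.+1) (b0 : forall i, 0 <= b i).

Let tge : {homo t : i j / (i <= j)%N >-> i <= j}.
Proof. by apply: (@homo_leq _ t <=%R) => //; exact: le_trans. Qed.

(* Off this event, the counts in ]c, e] involve at most n arrivals. *)
Definition late_arrival c e n : set T := [set w | exists2 j, (n <= j)%N & c < Gam j w <= e].

Lemma measurable_late_arrival c e n : measurable (late_arrival c e n).
Proof.
rewrite (_ : late_arrival c e n = \bigcup_(j in [set j | (n <= j)%N]) (Gam j @^-1` `]c, e])).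
  by apply: bigcup_measurable => j _; exact: measurable_funPTI.
apply/seteqP; split => w.
  by move=> [j nj h]; exists j => //=; rewrite in_itv.
by move=> [j nj /=]; rewrite in_itv/= => h; exists j.
Qed.

Lemma arrivals_finite c e n s w : s <= e -> ~ late_arrival c e n w ->
  arrivals Gam c s w = \sum_(j < n) (c < Gam j w <= s)%R%:R.
Proof.
move=> se nB; rewrite /arrivals counting_dirac (nneseries_split 0 n)//.
rewrite eseries0 ?adde0; last first.
  move=> j nj _; rewrite diracE memNset// => /andP[cj js]; apply: nB.
  by exists j; rewrite ?cj ?(le_trans js).
rewrite add0n big_mkord sumEFin/=; apply: eq_bigr => j _.
by rewrite indicE; congr ((nat_of_bool _)%:R); apply/idP/idP; rewrite inE.
Qed.

(** Links the two forms of the conditional variance: the left one enters the Gaussian mixture, the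
    right one has computable moments. *)
Lemma step_sumE n w : ~ late_arrival (t 0%N) (t k) n w ->
  \sum_(j < n) step k t b (Gam j w) ^+ 2 =
  step_sum Gam (t 0%N) t (fun i => b i ^+ 2) k w.
Proof.
move=> nB.
under eq_bigr do rewrite step_sqr//.
rewrite exchange_big/=; apply: eq_bigr => i _.
rewrite -mulr_sumr; congr (_ * _).
rewrite /incr /= !(arrivals_finite _ nB); last 2 first.
- by apply: tge; exact: ltnW.
- by apply: tge.
rewrite -sumrB; apply: eq_bigr => j _.
have := tS i; have := tge (leq0n i).
set u := Gam j w => h1 h2.
have [ui|ui] := leP u (t i).
  by rewrite (le_trans ui h2) subrr.
by rewrite (le_lt_trans h1 ui)/= subr0.
Qed.

Let mu := \sum_(i < k) b i ^+ 2 * (t i.+1 - t i).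

Lemma step_kolmogorov (M : R) n (x : R) : 0 < mu -> (forall i : nat, (i < k)%N -> b i ^+ 2 <= M) ->
  `|fine (P [set w | (\sum_(j < n) W j w * step k t b (Gam j w) <= x)%R]) -
    Phi (x / Num.sqrt (sigma ^+ 2 * mu))| <=
  taylor_cst * (M / mu) + fine (P (late_arrival (t 0%N) (t k) n)).
Proof.
move=> mu0 bM.
pose V := step_sum Gam (t 0%N) t (fun i => b i ^+ 2) k.
pose Vn w := \sum_(j < n) step k t b (Gam j w) ^+ 2.
pose s := sigma * Num.sqrt mu.
have s0 : 0 < s by rewrite mulr_gt0 ?sqrtr_gt0.
have s2 : s ^+ 2 = sigma ^+ 2 * mu by rewrite exprMn sqr_sqrtr// ltW.
rewrite -s2 sqrtr_sqr (gtr0_norm s0).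
pose y : R := x / s.
pose f w := gcdf (Vn w / mu) y.
pose kap : R := y * normal_pdf 0 1 y / 2.
pose B := late_arrival (t 0%N) (t k) n.
have mB : measurable B by exact: measurable_late_arrival.
set C := taylor_cst.
have C0 : 0 <= C by exact: taylor_cst_ge0.
have VL2 : V \in Lfun P 2%:E by exact: (step_sum_Lfun2 poissonG t0).
have VL1 := Lfun21 VL2.
have EV : ('E_P[V] = mu%:E)%E by exact: (expectation_step_sum poissonG t0).
(* Each [b i ^+ 4] is at most [M * b i ^+ 2]. *)
have VV : ('V_P[V] <= (M * mu)%:E)%E.
  rewrite (variance_step_sum poissonG t0)// lee_fin /mu mulr_sumr.
  apply: ler_sum => i _; rewrite expr2 -mulrA ler_wpM2r ?bM//.
  by rewrite mulr_ge0 ?sqr_ge0// subr_ge0.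
have mV : measurable_fun setT V by case/andP: (VL1) => /[!inE].
have mVn : measurable_fun setT Vn.
  apply: measurable_sum => j; apply: measurable_funX.
  exact: measurableT_comp (measurable_step _ _ _) _.
have mf : measurable_fun setT f.
  by apply: (measurableT_comp (measurable_gcdf y)); exact: measurable_funM.
have Pf : (P [set w | (\sum_(j < n) W j w * step k t b (Gam j w) <= x)%R] = 'E_P[f])%E.
  rewrite (gaussian_mixture_step sigma0 indW lawW indWG)// expectation.unlock.
  apply: eq_integral => w _; congr EFin.
  rewrite /f -(gcdf_scale (Vn w / mu) y s0) s2 /y; congr (gcdf _ _).
    by rewrite -/(Vn w); field; rewrite gt_eqF.
  by rewrite mulrC divfK// gt_eqF.
have fL1 : f \in Lfun P 1.
  apply: Lfun21; apply: Lfun2_sqr => //.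
  apply: (@le_lt_trans _ _ (\int[P]_w (cst 1%:E w))%E).
    apply: ge0_le_integral => //.
    - by move=> w _; rewrite lee_fin sqr_ge0.
    - by apply/measurable_EFinP; exact: measurable_funX.
    - by move=> w _; rewrite lee_fin expr_le1 ?gcdf_ge0 ?gcdf_le1.
  by rewrite integral_cst// mul1e; apply: le_lt_trans (probability_le1 _ _) (ltry _).
(* Adds the linear Taylor term [kap * (V / mu - 1)]. Its mean is 0, so [X] has mean [E f - Phi y]
   while being pointwise of second order. *)
pose X := (f \+ ((kap / mu) \o* V) \+ cst (- Phi y - kap))%R.
have EX : ('E_P[X] = (fine 'E_P[f] - Phi y)%:E)%E.
  rewrite /X expectationD//; last 2 first.
  - by apply: rpredD; [exact: fL1|exact: Lfun_scale].
  - exact: Lfun_cst.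
  rewrite expectationD//; last exact: Lfun_scale.
  rewrite expectationZl// EV expectation_cst -(fineK (expectation_fin_num fL1)).
  by rewrite -EFinM -!EFinD; congr EFin; rewrite /=; field; rewrite gt_eqF.
have XB w : `|X w| <= C / mu ^+ 2 * ((V w - mu) ^+ 2) + \1_B w.
  have tay v := gcdf_taylor v y.
  have e1 : C / mu ^+ 2 * ((V w - mu) ^+ 2) = C * (V w / mu - 1) ^+ 2.
    by field; rewrite gt_eqF.
  (* The first difference vanishes off [B] and is at most 1 on it; the rest is the Taylor
     remainder. *)
  have e2 : X w = (f w - gcdf (V w / mu) y) + (gcdf (V w / mu) y - Phi y + kap * (V w / mu - 1)).
    by rewrite /X/=; field; rewrite gt_eqF.
  rewrite e1 e2 [leRHS]addrC; apply: le_trans (ler_normD _ _) _; apply: lerD; last exact: tay.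
  rewrite indicE; case: (boolP (w \in B)) => [_|/negP wB].
    have := gcdf_ge0 (V w / mu) y; have := gcdf_le1 (V w / mu) y.
    have := gcdf_ge0 (Vn w / mu) y; have := gcdf_le1 (Vn w / mu) y.
    exact: dist_le1.
  rewrite /f /Vn step_sumE ?subrr ?normr0//.
  by move=> h; apply: wB; rewrite inE.
rewrite Pf -lee_fin.
change (`| (fine 'E_P[f] - Phi y)%:E | <= (C * (M / mu) + fine (P B))%:E)%E.
rewrite -EX.
have mX : measurable_fun setT X.
  apply: measurable_funD => //; apply: measurable_funD => //.
  exact: measurable_funM.
rewrite expectation.unlock.
apply: le_trans (le_abse_integral _ _ _) _ => //; first exact/measurable_EFinP.
apply: (@le_trans _ _ (\int[P]_w (C / mu ^+ 2 * ((V w - mu) ^+ 2) + \1_B w)%:E)%E).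
  apply: ge0_le_integral => //.
  - by apply: measurableT_comp => //; exact/measurable_EFinP.
  - apply/measurable_EFinP; apply: measurable_funD; last exact: measurable_indic.
    by apply: measurable_funM => //; apply: measurable_funX; exact: measurable_funB.
  - by move=> w _; rewrite abse_EFin lee_fin.
have Cmu : 0 <= C / mu ^+ 2 by rewrite divr_ge0// sqr_ge0.
have mV2 : measurable_fun setT (fun w => ((V w - mu) ^+ 2)%:E).
  by apply/measurable_EFinP; apply: measurable_funX; exact: measurable_funB.
under eq_integral do rewrite EFinD EFinM.
rewrite ge0_integralD//; last 3 first.
- by move=> w _; rewrite mule_ge0// lee_fin// sqr_ge0.
- exact: emeasurable_funM.
- by apply/measurable_EFinP; exact: measurable_indic.
rewrite ge0_integralZl//; last by move=> w _; rewrite lee_fin sqr_ge0.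
rewrite integral_indic// setIT EFinD fineK ?fin_num_measure//.
apply: leeD => //.
have -> : (\int[P]_w ((V w - mu) ^+ 2)%:E = 'V_P[V])%E.
  rewrite /variance covariance.unlock EV expectation.unlock.
  by apply: eq_integral => w _; rewrite expr2.
have -> : C * (M / mu) = C / mu ^+ 2 * (M * mu) by field; rewrite gt_eqF.
by rewrite [leRHS]EFinM; apply: lee_wpmul2l.
Qed.

End step_bound.

(** * Step approximation of the power x^(-1/alpha) *)

Section power_grid.
Context {R : realType}.
Variable alpha : R.
Hypothesis alpha02 : 0 < alpha < 2.
Local Notation q := (fun x : R => x `^ (- alpha^-1)).

Let alpha0 : 0 < alpha. Proof. by case/andP: alpha02. Qed.
Let alpha2 : 0 < 2 - alpha. Proof. by rewrite subr_gt0; case/andP: alpha02. Qed.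

(** The integral of [t^(-2/alpha)] over ]x, +oo[, that is, the variance of R_(x, oo) when sigma is
    1. *)
Definition tail_var (x : R) : R := alpha / (2 - alpha) * x `^ ((alpha - 2) / alpha).

Lemma continuous_powR_gt0 (a x : R) : 0 < x -> {for x, continuous (@powR R ^~ a)}.
Proof.
move=> x0; apply/differentiable_continuous/derivable1_diffP.
by have [] := is_derive1_powR a x0.
Qed.

Lemma powR_sqrN (x : R) : 0 < x -> q x ^+ 2 = x `^ (- (2 / alpha)).
Proof.
move=> x0; rewrite -powR_mulrn ?powR_ge0// -powRrM; congr (_ `^ _).
by field; rewrite gt_eqF.
Qed.

Lemma powR_sqrN_le (c x : R) : 0 < c -> c <= x -> q x ^+ 2 <= c `^ (- (2 / alpha)).
Proof.
move=> c0 cx; have x0 := lt_le_trans c0 cx.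
rewrite powR_sqrN// !powRN lef_pV2 ?posrE ?powR_gt0//.
by apply: ge0_ler_powR; rewrite ?nnegrE ?(ltW c0) ?(ltW x0)// divr_ge0// ltW.
Qed.

Lemma tail_var_mvt (u v : R) : 0 < u -> u < v ->
  exists2 xi, u < xi < v & tail_var u - tail_var v = q xi ^+ 2 * (v - u).
Proof.
move=> u0 uv.
have D (x : R) : 0 < x -> is_derive x 1 tail_var (- (q x ^+ 2)).
  move=> x0; rewrite powR_sqrN//.
  have := is_derive1_powR ((alpha - 2) / alpha) x0.
  move=> h; have := is_deriveZ (alpha / (2 - alpha)) h.
  rewrite /GRing.scale/= => {}h; apply: is_derive_eq.
  have e1 : alpha / (2 - alpha) * ((alpha - 2) / alpha) = -1.
    by field; rewrite !gt_eqF.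
  have e2 : (alpha - 2) / alpha - 1 = - (2 / alpha) by field; rewrite gt_eqF.
  by rewrite mulrA e1 e2 mulN1r.
have [||xi] := @MVT R tail_var (fun x => - (q x ^+ 2)) u v uv.
- by move=> x; rewrite in_itv/= => /andP[ux _]; apply: D; exact: lt_trans ux.
- apply: derivable_within_continuous => x; rewrite in_itv/= => /andP[ux _].
  by have [] := D x (lt_le_trans u0 ux).
rewrite in_itv/= => uxiv h; exists xi => //.
by rewrite -opprB h; ring.
Qed.

Lemma tail_var_gt0 (c : R) : 0 < c -> 0 < tail_var c.
Proof. by move=> c0; rewrite mulr_gt0 ?powR_gt0// divr_gt0. Qed.

Lemma tail_var_lt (c e : R) : 0 < c -> c < e -> tail_var e < tail_var c.
Proof.
move=> c0 ce; rewrite -subr_gt0; have [xi /andP[cxi _] ->] := tail_var_mvt c0 ce.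
by rewrite mulr_gt0 ?subr_gt0// exprn_gt0// powR_gt0// (lt_trans c0).
Qed.

Variables (c e : R).
Hypotheses (c0 : 0 < c) (ce : c < e).

Definition grid n (i : nat) : R := c + (e - c) / n.+1%:R * i%:R.

Lemma grid0 n : grid n 0 = c. Proof. by rewrite /grid mulr0 addr0. Qed.

Lemma gridn n : grid n n.+1 = e.
Proof. by rewrite /grid divfK ?pnatr_eq0// addrC subrK. Qed.

Lemma gridS n i : grid n i.+1 = grid n i + (e - c) / n.+1%:R.
Proof. by rewrite /grid -[i.+1%:R]natr1 mulrDr mulr1 addrA. Qed.

Let h0 n : 0 < (e - c) / n.+1%:R. Proof. by rewrite divr_gt0 ?subr_gt0. Qed.

Lemma grid_lt n i : grid n i < grid n i.+1.
Proof. by rewrite gridS ltrDl. Qed.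

Lemma grid_ge n i : c <= grid n i.
Proof. by rewrite /grid lerDl mulr_ge0// ltW. Qed.

Let grid_gt0 n i : 0 < grid n i. Proof. exact: lt_le_trans (grid_ge n i). Qed.

(* A mean value point of [tail_var] in each cell, so that the sum in
   [sum_amplitude] is exact. *)
Definition node n i : R := sval (cid2 (tail_var_mvt (grid_gt0 n i) (grid_lt n i))).

Lemma node_itv n i : grid n i < node n i < grid n i.+1.
Proof. by rewrite /node; case: cid2. Qed.

Lemma nodeE n i :
  tail_var (grid n i) - tail_var (grid n i.+1) = q (node n i) ^+ 2 * (grid n i.+1 - grid n i).
Proof. by rewrite /node; case: cid2. Qed.

Lemma node_ge n i : c <= node n i.
Proof. by case/andP: (node_itv n i) => /ltW h _; exact: le_trans (grid_ge n i) h. Qed.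

Definition amplitude n i : R := q (node n i).

Lemma sum_amplitude n :
  \sum_(i < n.+1) amplitude n i ^+ 2 * (grid n i.+1 - grid n i) = tail_var c - tail_var e.
Proof.
rewrite -(grid0 n) -(gridn n).
under eq_bigr do rewrite -nodeE.
rewrite -(big_mkord xpredT (fun i => tail_var (grid n i) - tail_var (grid n i.+1))).
rewrite (@telescope_sumr_eq _ _ _ (fun i => - tail_var (grid n i)))//.
  by rewrite opprK addrC.
by move=> i _; rewrite opprK addrC.
Qed.

Lemma step_cell (k : nat) (t b : nat -> R) i u : (forall j, t j <= t j.+1) ->
  (i < k)%N -> t i < u <= t i.+1 -> step k t b u = b i.
Proof.
move=> tS ik tu; rewrite /step (bigD1 (Ordinal ik))//= tu mulr1 big1 ?addr0// => j ji.
have tge : {homo t : i j / (i <= j)%N >-> i <= j}.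
  by apply: (@homo_leq _ t <=%R) => //; exact: le_trans.
case/andP: tu => tiu uti.
have : (j < i)%N || (i < j)%N by rewrite -neq_ltn -val_eqE in ji *.
case/orP => [lt|lt].
  have := tge _ _ lt => h; rewrite [u <= _]leNgt (le_lt_trans h tiu)/=.
  by rewrite andbF mulr0.
by have := tge _ _ lt => h; rewrite [t j < u]ltNge (le_trans uti h) mulr0.
Qed.

Lemma step_out (k : nat) (t b : nat -> R) u : (forall j, t j <= t j.+1) ->
  ~~ (t 0%N < u <= t k) -> step k t b u = 0.
Proof.
move=> tS tu; rewrite /step big1// => i _.
have tge : {homo t : i j / (i <= j)%N >-> i <= j}.
  by apply: (@homo_leq _ t <=%R) => //; exact: le_trans.
have -> : (t i < u <= t i.+1) = false; last by rewrite mulr0.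
apply/negbTE; apply: contra tu => /andP[h1 h2].
by rewrite (le_lt_trans (tge 0%N i _) h1)// (le_trans h2)// tge.
Qed.

Lemma cell_ex (k : nat) (t : nat -> R) u : t 0%N < u <= t k ->
  exists2 i, (i < k)%N & t i < u <= t i.+1.
Proof.
elim: k => [|k IH] /andP[h1 h2]; first by move: (lt_le_trans h1 h2); rewrite ltxx.
have [uk|uk] := leP u (t k).
  by have [|i ik ?] := IH; [rewrite h1|exists i => //; exact: ltnW].
by exists k => //; rewrite uk.
Qed.

(** The node and [x] share a cell, whose length tends to 0, so continuity of the power at [x]
    concludes. *)
Lemma cvg_step (x : R) : c < x <= e ->
  step n.+1 (grid n) (amplitude n) x @[n --> \oo] --> q x.
Proof.
move=> /andP[cx xe]; have x0 : 0 < x by exact: lt_trans cx.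
have gS n j : grid n j <= grid n j.+1 by rewrite ltW// grid_lt.
apply/cvgrPdist_lt => eps eps0.
have /cvgrPdist_lt/(_ _ eps0)[d /= d0 dq] := @continuous_powR_gt0 (- alpha^-1) x x0.
near=> n.
have [|i ik xi] := @cell_ex n.+1 (grid n) x.
  by rewrite grid0 gridn cx.
rewrite (step_cell _ (gS n) ik xi); apply: dq => /=.
have hn : (e - c) / n.+1%:R < d.
  rewrite mulrC -ltr_pdivlMr ?subr_gt0//; near: n.
  have dec : 0 < d / (e - c) by rewrite divr_gt0 ?subr_gt0.
  exact: (near_infty_natSinv_lt (PosNum dec)).
move: (node_itv n i) xi; rewrite gridS => /andP[h1 h2] /andP[h3 h4].
by move: (_ / _) (grid n i) (node n i) hn h1 h2 h3 h4 => h G N *; rewrite /ball/= ltr_norml; lra.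
Unshelve. all: end_near. Qed.

End power_grid.

(** * From step functions to the truncated series *)

Section truncated_series_law.
Context {R : realType} d (T : measurableType d) (P : probability T R).

Lemma cvg_probability0 (A : nat -> set T) : (forall n, measurable (A n)) ->
  {ae P, forall w, \forall n \near \oo, ~ A n w} ->
  fine (P (A n)) @[n --> \oo] --> (0 : R).
Proof.
move=> mA aeA.
have [|||||_ _] := @dominated_convergence _ T R P setT measurableT
  (fun n w => (\1_(A n) w)%:E) (cst 0%E) (cst 1%E).
- by move=> n; apply/measurable_EFinP; exact: measurable_indic.
- exact: measurable_cst.
- case: aeA => N [mN PN NA]; exists N; split => // w /= h.
  apply: NA => /= nA; apply: h => _.
  apply: cvg_near_cst; apply: filterS nA => n nA; congr EFin.
  by rewrite indicE memNset.
- by apply: finite_measure_integrable_cst.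
- apply: aeW => w n _; rewrite /= lee_fin ger0_norm//.
rewrite integral0 => h.
apply: fine_cvg; apply: cvg_trans h; apply: near_eq_cvg; apply: nearW => n /=.
by rewrite integral_indic// setIT.
Qed.

Lemma ae_probability1 (S : set T) : measurable S -> P S = 1%E -> {ae P, forall w, S w}.
Proof.
move=> mS PS; exists (~` S); split => //; first exact: measurableC.
by rewrite probability_setC// PS subee.
Qed.

Variables (W Gam : nat -> {RV P >-> R}) (alpha sigma : R).
Hypotheses (alpha02 : 0 < alpha < 2) (sigma0 : 0 < sigma).
Hypothesis poissonG : forall (s t : R) k, 0 <= s -> s < t ->
  P (arrivals_eq Gam s t k) = (poisson_pmf (t - s) k)%:E.

(** An arrival at [e] forces a nonzero count in ]s, e], of probability [1 - expR (- (e - s))], which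
    is small for [s] near [e]. This reconciles the open interval of the series with the closed right
    end of the last grid cell. *)
Lemma arrival_neq (e : R) j : 0 < e -> P (Gam j @^-1` [set e]) = 0%E.
Proof.
move=> e0; have mA : measurable (Gam j @^-1` [set e]) by exact: measurable_funPTI.
suff : fine (P (Gam j @^-1` [set e])) <= 0.
  move=> h; apply/eqP; rewrite eq_le measure_ge0 andbT -(fineK (fin_num_measure P _ mA)).
  by rewrite lee_fin.
apply/ler_addgt0Pr => eta eta0; rewrite add0r.
(* The Poisson law of the counts is available for [s >= 0] only. *)
pose s := Num.max 0 (e - eta).
have s0 : 0 <= s by rewrite le_max lexx.
have se : s < e by rewrite gt_max e0 gtrBl.
have es : e - s <= eta by rewrite lerBlDr -lerBlDl le_max lexx orbT.
have := poissonG 0%N s0 se; rewrite /poisson_pmf subr_gt0 se expr0 fact0 invr1 !mul1r => PA.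
have mA0 := measurable_arrivals_eq Gam s e 0.
rewrite -lee_fin fineK ?fin_num_measure//.
apply: (@le_trans _ _ (P (~` arrivals_eq Gam s e 0))).
  apply: le_measure; rewrite ?inE//; first exact: measurableC.
  move=> w /= Ge; rewrite arrivals_eqE/= => h.
  have : hits Gam s e w j by rewrite /hits/= Ge se lexx.
  move: h; rewrite /counting; case: asboolP => // fin [] /eqP; rewrite pnatr_eq0 cardfs_eq0 => /eqP h0.
  by rewrite -[hits _ _ _ _]/(hits Gam s e w) (fset_set_set0 fin h0).
rewrite probability_setC// PA -EFinB lee_fin.
by have := expR_ge1Dx (- (e - s)); lra.
Qed.

Variables (c e : R).
Hypotheses (c0 : 0 < c) (ce : c < e).

(** One index governs both the number of arrivals kept and the mesh of the grid. *)
Let Rn n w := \sum_(j < n) W j w *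
  step n.+1 (grid c e n) (amplitude alpha02 c0 ce n) (Gam j w).

Lemma cvg_sum_ord (N : nat) (u : 'I_N -> nat -> R) (l : 'I_N -> R) :
  (forall j, u j n @[n --> \oo] --> l j) ->
  (\sum_(j < N) u j n) @[n --> \oo] --> \sum_(j < N) l j.
Proof.
elim: N u l => [|N IH] u l ul.
  rewrite big_ord0; under eq_fun do rewrite big_ord0; exact: cvg_cst.
rewrite big_ord_recr/=; under eq_fun do rewrite big_ord_recr/=.
by apply: cvgD => //; apply: IH => j; exact: ul.
Qed.

Lemma cvg_step_series w : finite_set (hits Gam c e w) -> (forall j, Gam j w <> e) ->
  Rn n w @[n --> \oo] --> truncated_series W Gam alpha c e w.
Proof.
move=> fin neqe.
have [N hN] : exists N, hits Gam c e w `<=` `I_N.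
  exists (\max_(i <- fset_set (hits Gam c e w)) i).+1 => j hj /=.
  have jin : j \in fset_set (hits Gam c e w) by rewrite in_fset_set// inE.
  by rewrite ltnS; apply/leq_bigmax_seq.
have out j : ~ (j < N)%N -> ~~ (c < Gam j w <= e).
  by move=> jN; apply/negP => h; apply: jN; exact: hN.
have -> : truncated_series W Gam alpha c e w =
    \sum_(j < N) W j w * (if c < Gam j w <= e then Gam j w `^ (- alpha^-1) else 0).
  rewrite /truncated_series fsbig_mkcond.
  rewrite (fsbig_ord _ N (fun j => W j w * (if c < Gam j w <= e then Gam j w `^ (- alpha^-1) else 0))).
  apply/esym; rewrite (fsbig_widen `I_N setT)//; last first.
    by move=> j [_ /= /out /negbTE ->]; rewrite mulr0.
  apply: eq_fsbigr => j _; rewrite patchE.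
  have -> : (j \in [set j | c < Gam j w < e]) = (c < Gam j w <= e).
    apply/idP/idP; rewrite inE/= => /andP[-> h]/=; first exact: ltW.
    by rewrite lt_neqAle h andbT; apply/eqP; exact: neqe.
  by case: ifP => _; rewrite ?mulr0.
apply: (@cvg_trans _ ((\sum_(j < N) W j w * step n.+1 (grid c e n) (amplitude alpha02 c0 ce n) (Gam j w)) @[n --> \oo])).
  apply: near_eq_cvg; exists N => // n /= Nn.
  rewrite /Rn -(subnKC Nn) big_split_ord/= [X in _ = _ + X]big1 ?addr0// => i _.
  rewrite step_out ?mulr0//; first by move=> j; rewrite ltW// grid_lt.
  by rewrite grid0 subnKC// gridn; apply: out; apply/negP; rewrite -leqNgt leq_addr.
apply: cvg_sum_ord => j; apply: cvgMr => //.
have [h|h] := boolP (c < Gam j w <= e); first exact: cvg_step.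
apply: cvg_near_cst; apply: nearW => n; apply: step_out.
  by move=> i; rewrite ltW// grid_lt.
by rewrite grid0 gridn.
Qed.

Lemma fine_probability_leU (A B C : set T) : measurable A -> measurable B ->
  measurable C -> A `<=` B `|` C -> fine (P A) <= fine (P B) + fine (P C).
Proof.
move=> mA mB mC AB; rewrite -lee_fin EFinD !fineK ?fin_num_measure//.
apply: le_trans (measureU2 _ _ _) => //; apply: le_measure; rewrite ?inE//.
exact: measurableU.
Qed.

Let measurable_Rn n : measurable_fun setT (Rn n).
Proof.
apply: measurable_sum => j; apply: measurable_funM => //.
by apply: (measurableT_comp (measurable_step _ _ _)).
Qed.

Let Tr w := truncated_series W Gam alpha c e w.

Let measurable_Tr : measurable_fun setT Tr.
Proof. exact: (@measurable_funPT _ _ _ _ (truncated_RV W Gam alpha c e)). Qed.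

Let measurable_le_set (X : T -> R) x : measurable_fun setT X ->
  measurable [set w | X w <= x].
Proof.
move=> mX; rewrite -[X in measurable X]setTI.
rewrite (_ : [set w | _] = X @^-1` `]-oo, x]); first exact: mX.
by apply/seteqP; split => w /=; rewrite in_itv.
Qed.

Let far (delta : R) n : set T := [set w | delta < `|Rn n w - Tr w|].

Let measurable_far delta n : measurable (far delta n).
Proof.
rewrite (_ : far delta n = ~` [set w | `|Rn n w - Tr w| <= delta]).
  apply: measurableC; apply: measurable_le_set.
  by apply: measurableT_comp => //; apply: measurable_funB => //; exact: measurable_Rn.
by apply/seteqP; split => w /=; rewrite /far/= ltNge => /negP.
Qed.

Hypotheses (indW : mutually_independent W)
  (lawW : forall j, has_law (W j) (normal_prob 0 sigma))
  (indWG : independent_seq W Gam).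

Let ae_good : {ae P, forall w, finite_set (hits Gam c e w) /\ forall j, Gam j w <> e}.
Proof.
have e0 : 0 < e by exact: lt_trans ce.
have h1 : {ae P, forall w, (counting (hits Gam c e w) < +oo :> \bar R)%E}.
  apply: ae_probability1; first exact: measurable_lty_counting.
  by apply: counting_hits_lty => //; exact: ltW.
have h2 : {ae P, forall w, forall j, Gam j w <> e}.
  apply: ae_foralln => j; exists (Gam j @^-1` [set e]); split.
  - exact: measurable_funPTI.
  - exact: arrival_neq.
  - by move=> w /= /contrapT.
apply: filterS2 h1 h2 => w h1 h2; split => //.
by move: h1; rewrite /counting; case: asboolP.
Qed.

Let cvg_late : fine (P (late_arrival Gam c e n)) @[n --> \oo] --> (0 : R).
Proof.
apply: cvg_probability0; first by move=> n; exact: measurable_late_arrival.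
apply: filterS ae_good => w [fin _].
exists (\max_(i <- fset_set (hits Gam c e w)) i).+1 => // n /= ltn [j nj hj].
have jin : j \in fset_set (hits Gam c e w) by rewrite in_fset_set// inE.
have := leq_trans ltn nj; apply/negP; rewrite -leqNgt.
exact: (@leq_bigmax_seq _ _ predT id).
Qed.

Let cvg_far (delta : R) : 0 < delta -> fine (P (far delta n)) @[n --> \oo] --> (0 : R).
Proof.
move=> delta0; apply: cvg_probability0; first by move=> n; exact: measurable_far.
apply: filterS ae_good => w [fin neqe].
have /cvgrPdist_le/(_ _ delta0) := cvg_step_series fin neqe.
by apply: filterS => n h; rewrite /far/=; apply/negP; rewrite -leNgt distrC.
Qed.

(** [Rn] tends to the series in probability, so its distribution functions at [x - delta] and
    [x + delta] enclose that of the series; the Lipschitz bound on [Phi] absorbs the shift. *)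
Lemma truncated_kolmogorov (x : R) :
  `|fine (cdf (truncated_RV W Gam alpha c e : {RV P >-> R}) x) -
    Phi (x / Num.sqrt (sigma ^+ 2 * (tail_var alpha c - tail_var alpha e)))| <=
  taylor_cst * (c `^ (- (2 / alpha)) / (tail_var alpha c - tail_var alpha e)).
Proof.
set mu := tail_var alpha c - tail_var alpha e.
have mu0 : 0 < mu by rewrite subr_gt0 tail_var_lt.
set s := Num.sqrt _; set B := taylor_cst * _.
have s0 : 0 < s by rewrite sqrtr_gt0 mulr_gt0// exprn_gt0.
have Rn_le n (y : R) : `|fine (P [set w | Rn n w <= y]) - Phi (y / s)| <=
    B + fine (P (late_arrival Gam c e n)).
  have t0 : 0 <= grid c e n 0 by rewrite grid0 ltW.
  have tS i : grid c e n i <= grid c e n i.+1 by rewrite ltW// grid_lt.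
  have b0 i : 0 <= amplitude alpha02 c0 ce n i by exact: powR_ge0.
  have := step_kolmogorov sigma0 indW lawW indWG poissonG (k := n.+1) t0 tS b0.
  move=> /(_ (c `^ (- (2 / alpha))) n y).
  rewrite sum_amplitude grid0 gridn -/mu -/s; apply => // i _.
  by apply: powR_sqrN_le => //; exact: node_ge.
have -> : fine (cdf (truncated_RV W Gam alpha c e : {RV P >-> R}) x) =
    fine (P [set w | Tr w <= x]).
  by congr (fine (P _)); apply/seteqP; split => w /=; rewrite in_itv.
have up delta n : fine (P [set w | Tr w <= x]) <=
    fine (P [set w | Rn n w <= x + delta]) + fine (P (far delta n)).
  apply: fine_probability_leU; [exact: measurable_le_set|exact: measurable_le_set|exact: measurable_far|].
  move=> w /= h; have [h'|h'] := leP `|Rn n w - Tr w| delta; [left|by right].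
  by move: h'; rewrite ler_norml => /andP[_]; rewrite lerBlDl => /le_trans; apply; rewrite lerD2r.
have dn delta n : fine (P [set w | Rn n w <= x - delta]) <=
    fine (P [set w | Tr w <= x]) + fine (P (far delta n)).
  apply: fine_probability_leU; [exact: measurable_le_set|exact: measurable_le_set|exact: measurable_far|].
  move=> w /= h; have [h'|h'] := leP `|Rn n w - Tr w| delta; [left|by right].
  move: h'; rewrite ler_norml => /andP[+ _] => h1.
  by move: (Rn n w) (Tr w) h h1 => a b; lra.
apply/ler_addgt0Pr => eps eps0.
pose q : R := normal_peak 1; have q0 : 0 <= q by exact: normal_peak_ge0.
(* Makes the Lipschitz cost [q * delta / s] at most [eps / 3]; the late arrivals and the event [far]
   take the other two thirds. *)
pose delta := eps / 3 * s / (q + 1).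
have q1 : 0 < q + 1 by rewrite ltr_wpDl.
have delta0 : 0 < delta by rewrite !(mulr_gt0, divr_gt0) ?invr_gt0.
have qd : q * (delta / s) <= eps / 3.
  rewrite /delta mulrAC mulfK ?gt_eqF// mulrCA ler_piMr//; first by rewrite divr_ge0// ltW.
  by rewrite ler_pdivrMr// mul1r lerDl.
have lip y : `|y - x| = delta -> `|Phi (y / s) - Phi (x / s)| <= eps / 3.
  move=> yx; apply: (le_trans (Phi_lipschitz _ _)).
  by rewrite -mulrBl normrM yx ger0_norm ?invr_ge0 ?(ltW s0).
have e3 : 0 < eps / 3 by rewrite divr_gt0.
have /cvgrPdist_le/(_ _ e3) := cvg_late.
have /cvgrPdist_le/(_ _ e3) := cvg_far delta0.
move=> [N1 _ far_le] [N2 _ late_le]; pose n := maxn N1 N2.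
have /= := far_le n (leq_maxl _ _); have /= := late_le n (leq_maxr _ _).
rewrite !sub0r !normrN => /(le_trans (ler_norm _)) h1 /(le_trans (ler_norm _)) h2.
have := Rn_le n (x + delta); have := Rn_le n (x - delta).
have := lip (x + delta); have := lip (x - delta).
rewrite addrAC subrr add0r normrN addrAC subrr add0r ger0_norm ?(ltW delta0)//.
move=> /(_ erefl) + /(_ erefl); have := up delta n; have := dn delta n.
move: h1 h2; rewrite !ler_norml => h1 h2 h3 h4 /andP[h5 h6] /andP[h7 h8] /andP[h9 h10] /andP[h11 h12].
clear Rn_le up dn far_le late_le lip.
move: (fine (P (far _ _))) (fine (P (late_arrival _ _ _ _))) h1 h2 h3 h4 h5 h6 h7 h8 h9 h10 h11 h12.
move: (fine (P [set w | Tr w <= x])) (fine (P [set w | Rn n w <= x - delta])) (fine (P [set w | Rn n w <= x + delta])).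
move: (Phi (x / s)) (Phi ((x - delta) / s)) (Phi ((x + delta) / s)) B.
move=> *; apply/andP; split; lra.
Qed.

End truncated_series_law.

(** * The limit of the truncated series *)

Section limit_law.
Context {R : realType}.

Lemma cvg_powRN_pinfty (p : R) : 0 < p -> x `^ (- p) @[x --> +oo] --> (0 : R).
Proof.
move=> p0; apply/cvgrPdist_lt => eps eps0.
near=> x; have x0 : 0 < x by near: x; exact: nbhs_pinfty_gt.
rewrite sub0r normrN ger0_norm ?powR_ge0// powRN invf_plt ?posrE ?powR_gt0//.
rewrite -[eps^-1](powRr1); last by rewrite invr_ge0 ltW.
rewrite -(mulVf (lt0r_neq0 p0)) powRrM.
apply: gt0_ltr_powR; rewrite ?nnegrE ?powR_ge0 ?(ltW x0) ?p0//.
Unshelve. all: end_near. Qed.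

Lemma cvg_tail_var (alpha : R) : 0 < alpha < 2 ->
  tail_var alpha x @[x --> +oo] --> (0 : R).
Proof.
move=> /andP[alpha0 alpha2].
rewrite -[X in _ --> X](mulr0 (alpha / (2 - alpha))); apply: cvgMr.
have -> : (alpha - 2) / alpha = - ((2 - alpha) / alpha) by rewrite -mulNr opprB.
by apply: cvg_powRN_pinfty; rewrite divr_gt0// subr_gt0.
Qed.

Lemma tail_var_ratio (alpha c : R) : 0 < alpha < 2 -> 0 < c ->
  c `^ (- (2 / alpha)) / tail_var alpha c = (2 - alpha) / alpha * c^-1.
Proof.
move=> /andP[alpha0 alpha2] c0.
have alpha2' : 0 < 2 - alpha by rewrite subr_gt0.
have -> : c `^ (- (2 / alpha)) = c `^ ((alpha - 2) / alpha) * c^-1.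
  rewrite -[c^-1]powR_inv1 ?(ltW c0)// -powRD; last by apply/implyP => _; rewrite gt_eqF.
  by congr (_ `^ _); field; rewrite gt_eqF.
rewrite /tail_var; have := powR_gt0 ((alpha - 2) / alpha) c0.
move: (c `^ _) => p p0; field; rewrite !gt_eqF//.
Qed.

Section continuity_points.
Context d (T : measurableType d) (P : probability T R) (X : {RV P >-> R}).

Lemma cdf_fine_nondecreasing : {homo fine \o cdf X : x y / x <= y}.
Proof.
by move=> x y xy /=; rewrite fine_le ?fin_num_measure// cdf_nondecreasing.
Qed.

Lemma cdf_fine_right_continuous : right_continuous (fine \o cdf X).
Proof.
move=> y; apply: fine_cvg; rewrite fineK ?fin_num_measure//.
exact: cdf_right_continuous.
Qed.

(** A monotone function has countably many discontinuities, and a nonempty open interval has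
    positive Lebesgue measure. *)
Lemma cdf_continuity_point (x delta : R) : 0 < delta ->
  exists2 y, x < y < x + delta & {for y, continuous (cdf X)}.
Proof.
move=> delta0; set F := fine \o cdf X.
apply: contrapT => noy.
have homoF : {in `[x, x + delta] &, {homo F : n m / n <= m}}.
  by move=> y z _ _; exact: cdf_fine_nondecreasing.
have := discontinuity_countable homoF.
have -> : [set y | y \in (`]x, x + delta[) /\ discontinuity F y] = [set` `]x, x + delta[].
  apply/seteqP; split => [y []//|y yx]; split => //.
  have ncont : ~ {for y, continuous (cdf X)}.
    by move=> cy; apply: noy; exists y.
  have EF z : cdf X z = (F z)%:E by rewrite fineK// fin_num_measure.
  have cl : cvg (F z @[z --> y^'-]).
    apply: nondecreasing_at_left_is_cvgr.
      by apply: nearW => z u v _ _; exact: cdf_fine_nondecreasing.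
    apply: nearW => z; exists 1 => _ [u _ <-].
    by rewrite -lee_fin -EF cdf_le1.
  have Fr := @cdf_fine_right_continuous y.
  split => //; first by apply/cvg_ex; exists (F y).
  rewrite (cvg_lim _ Fr)//; apply/eqP => lF; apply: ncont.
  have Fy : F z @[z --> y] --> F y.
    by apply/left_right_continuousP; split => //; rewrite /F -lF.
  have -> : cdf X = EFin \o F by apply/funext.
  by apply: cvg_EFin => //; exact: nearW.
move=> cnt; have := countable_lebesgue_measure0 cnt; rewrite lebesgue_measure_itv/= lte_fin ltrDl delta0.
by rewrite -EFinD addrAC subrr add0r => -[] /eqP; rewrite gt_eqF.
Qed.

(* A uniform bound at the continuity points extends to all points, since the
   distribution function is continuous on the right. *)
Lemma cdf_le_right (G : R -> R) (x : R) : continuous G ->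
  (forall y, {for y, continuous (cdf X)} -> fine (cdf X y) <= G y) ->
  fine (cdf X x) <= G x.
Proof.
move=> cG XG; apply/ler_addgt0Pr => eps eps0.
have /cvgrPdist_le/(_ _ eps0)[delta /= delta0 hd] := cG x.
have [y /andP[xy yx] cy] := cdf_continuity_point x delta0.
apply: (le_trans (cdf_fine_nondecreasing (ltW xy))).
apply: (le_trans (XG y cy)); rewrite -lerBlDl.
apply: le_trans (hd y _); first by rewrite distrC ler_norm.
by rewrite /= distrC ger0_norm ?subr_ge0 ?(ltW xy)// ltrBlDl.
Qed.

Lemma cdf_ge_right (G : R -> R) (x : R) : continuous G ->
  (forall y, {for y, continuous (cdf X)} -> G y <= fine (cdf X y)) ->
  G x <= fine (cdf X x).
Proof.
move=> cG XG.
have Fr := @cdf_fine_right_continuous x.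
apply/ler_addgt0Pr => eps eps0.
have e2 : 0 < eps / 2 by rewrite divr_gt0.
have /cvgrPdist_le/(_ _ e2)[d1 /= d10 hd1] := cG x.
have /cvgrPdist_le/(_ _ e2)[d2 /= d20 hd2] := Fr.
have d0 : 0 < Num.min d1 d2 by rewrite lt_min d10.
have [y /andP[xy yx] cy] := cdf_continuity_point x d0.
have yx' : `|x - y| < Num.min d1 d2.
  by rewrite distrC ger0_norm ?subr_ge0 ?(ltW xy)// ltrBlDl.
move: (yx'); rewrite lt_min => /andP[y1 y2].
have := hd1 y y1; have := hd2 y y2 xy; have := XG y cy.
move: (fine _) (fine _) (G x) (G y) => a b a' b'.
rewrite !ler_norml => h /andP[h1 h2] /andP[h3 h4]; lra.
Qed.

End continuity_points.

Lemma continuous_Phi_scale (s : R) : continuous (fun x : R => Phi (x / s)).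
Proof.
move=> x; apply: (@continuous_comp _ _ _ (fun y : R => y / s) Phi).
  exact: mulrr_continuous.
exact: Phi_continuous.
Qed.

Lemma S_infE (sigma alpha c : R) :
  S_inf sigma alpha c = Num.sqrt (sigma ^+ 2 * tail_var alpha c).
Proof. by rewrite /S_inf /tail_var !mulrA. Qed.

Section limit_kolmogorov.
Context d (T : measurableType d) (P : probability T R)
  d' (T' : measurableType d') (P' : probability T' R).
Variables (W Gam : nat -> {RV P >-> R}) (X : {RV P' >-> R}) (alpha sigma c : R).
Hypotheses (alpha02 : 0 < alpha < 2) (sigma0 : 0 < sigma) (c0 : 0 < c).
Hypothesis poissonG : forall (s t : R) k, 0 <= s -> s < t ->
  P (arrivals_eq Gam s t k) = (poisson_pmf (t - s) k)%:E.
Hypotheses (indW : mutually_independent W)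
  (lawW : forall j, has_law (W j) (normal_prob 0 sigma))
  (indWG : independent_seq W Gam).
Hypothesis cvgX : cvg_in_law +oo (fun e : R => truncated_RV W Gam alpha c e) X.

Lemma limit_kolmogorov (x : R) :
  `|fine (cdf X x) - Phi (x / S_inf sigma alpha c)| <=
  taylor_cst * ((2 - alpha) / alpha * c^-1).
Proof.
set B := taylor_cst * _; set G := fun y : R => Phi (y / S_inf sigma alpha c).
have tv0 := tail_var_gt0 alpha02 c0.
have cvg_tail : tail_var alpha c - tail_var alpha e @[e --> +oo] --> tail_var alpha c.
  by rewrite -[X in _ --> X]subr0; apply: cvgB; [exact: cvg_cst|exact: cvg_tail_var].
(* At continuity points, all three terms of the truncated bound converge as [e] grows. *)
have bound y : {for y, continuous (cdf X)} -> `|fine (cdf X y) - G y| <= B.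
  move=> cy.
  have cvgB1 : taylor_cst * (c `^ (- (2 / alpha)) / (tail_var alpha c - tail_var alpha e))
      @[e --> +oo] --> B.
    rewrite /B -tail_var_ratio//; apply: cvgMr; apply: cvgMr.
    by apply: cvgV => //; rewrite gt_eqF.
  have cvgF : fine (cdf (truncated_RV W Gam alpha c e : {RV P >-> R}) y)
      @[e --> +oo] --> fine (cdf X y).
    by apply: fine_cvg; rewrite fineK ?fin_num_measure//; exact: cvgX.
  have cvgG : Phi (y / Num.sqrt (sigma ^+ 2 * (tail_var alpha c - tail_var alpha e)))
      @[e --> +oo] --> G y.
    apply: (@cvg_comp _ _ _ _ Phi _ (nbhs (y / S_inf sigma alpha c))); last exact: Phi_continuous.
    rewrite S_infE; apply: cvgMr; apply: cvgV.
      by rewrite gt_eqF// sqrtr_gt0 mulr_gt0// exprn_gt0.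
    apply: (@cvg_comp _ _ _ _ Num.sqrt _ (nbhs (sigma ^+ 2 * tail_var alpha c))).
      exact: cvgMr.
    exact: sqrt_continuous.
  apply: ler_cvg_to (cvg_norm (cvgB cvgF cvgG)) cvgB1 _.
  have := nbhs_pinfty_gt (num_real c); apply: filterS => e ce.
  exact: truncated_kolmogorov.
have cG k : continuous (fun y => G y + k).
  by move=> y; apply: cvgD; [exact: continuous_Phi_scale|exact: cvg_cst].
(* The two one-sided bounds extend separately to all points. *)
have lo : G x - B <= fine (cdf X x).
  apply: (cdf_ge_right _ (cG (- B))) => y /bound.
  by rewrite ler_norml lerBrDr addrC => /andP[].
have hi : fine (cdf X x) <= G x + B.
  apply: (cdf_le_right _ (cG B)) => y /bound.
  by rewrite ler_norml lerBlDl => /andP[].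
by rewrite ler_norml lerBrDr addrC lo lerBlDl.
Qed.

Lemma cdf_standardize (s x : R) : 0 < s -> cdf (standardize s X) x = cdf X (x * s).
Proof.
move=> s0; congr (P' _); apply/seteqP; split => w /=;
  by rewrite !in_itv/= ler_pdivrMr.
Qed.

(** The lower bound removes the norm in the Landau estimate. *)
Lemma kolmogorov_standardize_le d'' (T'' : measurableType d'')
    (P'' : probability T'' R) (Z : {RV P'' >-> R}) :
  has_law Z (normal_prob 0 1) ->
  0 <= kolmogorov_dist (standardize (S_inf sigma alpha c) X) Z <=
  taylor_cst * ((2 - alpha) / alpha * c^-1).
Proof.
move=> lawZ; set s := S_inf sigma alpha c.
have s0 : 0 < s.
  by rewrite /s S_infE sqrtr_gt0 mulr_gt0 ?exprn_gt0// tail_var_gt0.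
have cdfZ x : cdf Z x = (Phi x)%:E.
  by rewrite /cdf lawZ// normal_prob_Nycc// subr0 divr1.
have le_bound x : `|fine (cdf (standardize s X) x) - fine (cdf Z x)| <=
    taylor_cst * ((2 - alpha) / alpha * c^-1).
  have := limit_kolmogorov (x * s).
  by rewrite -/s mulfK ?gt_eqF// cdf_standardize// cdfZ.
rewrite /kolmogorov_dist; set D := (X in sup X).
have ubD : ubound D (taylor_cst * ((2 - alpha) / alpha * c^-1)).
  by move=> _ [x _ <-].
apply/andP; split.
  apply: (@le_trans _ _ `|fine (cdf (standardize s X) 0) - fine (cdf Z 0)|) => //.
  by apply: ub_le_sup; [eexists; exact: ubD|exists 0].
by apply: ge_sup => //; exists `|fine (cdf (standardize s X) 0) - fine (cdf Z 0)|; exists 0.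
Qed.

End limit_kolmogorov.

End limit_law.

(** * Asymptotics of B1 *)

Section B1_asymptotics.
Context {R : realType}.
Implicit Types a p k x t : R.
Local Notation mu := (@lebesgue_measure R).

Lemma continuous_integral_FTC (f F : R -> R) (x y : R) : x < y ->
  (forall t, x <= t <= y -> {for t, continuous f}) ->
  (forall t, x <= t <= y -> is_derive t 1 F (f t)) ->
  (\int[mu]_(t in `[x, y]) (f t)%:E = (F y - F x)%:E)%E.
Proof.
move=> xy cf dF.
have cF t : x <= t <= y -> {for t, continuous F}.
  move=> /dF [+ _] => /derivable1_diffP/differentiable_continuous; exact.
rewrite (continuous_FTC2 (F := F))//.
- apply: continuous_in_subspaceT => t.
  by rewrite inE/= in_itv/= => /cf.
- split.
  + by move=> t; rewrite in_itv/= => /andP[xt ty]; have [] := dF t; rewrite ?(ltW xt) ?(ltW ty).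
  + by apply: cvg_at_right_filter; apply: cF; rewrite lexx ltW.
  + by apply: cvg_at_left_filter; apply: cF; rewrite lexx ltW.
- move=> t; rewrite in_itv/= => /andP[xt ty].
  by rewrite derive1E; apply: derive_val; apply: dF; rewrite (ltW xt) (ltW ty).
Qed.

Let h a t := t `^ (1 - a - 1) * expR (- t).

Let h_ge0 a t : 0 <= h a t.
Proof. by rewrite mulr_ge0 ?powR_ge0 ?expR_ge0. Qed.

Let measurable_h a (D : set R) : measurable_fun D (h a).
Proof.
apply: (@measurable_funS _ _ _ _ setT) => //.
apply: measurable_funM; first exact: measurable_powR.
by apply: measurableT_comp => //; exact: oppr_measurable.
Qed.

(** Near 0 the integrand is at most [t^(-a)], which is integrable as [a < 1]. An infinite integral
    would be read as 0 by [gamma_bar]. *)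
Lemma lower_gamma_lty a : 0 < a < 1 ->
  (\int[mu]_(t in `[0%R, 1%R]) (h a t)%:E < +oo)%E.
Proof.
move=> /andP[a0 a1]; have a1' : 0 < 1 - a by rewrite subr_gt0.
have mh (D : set R) : measurable_fun D (EFin \o h a).
  by apply/measurable_EFinP; exact: measurable_h.
rewrite -integral_itv_obnd_cbnd//.
(* Exhausts ]0, 1] away from the singularity; [n.+2] keeps every interval nondegenerate. *)
pose D n : set R := [set` `[n.+2%:R^-1, 1]].
have -> : [set` `]0, 1]] = \bigcup_n D n.
  apply/seteqP; split => t; rewrite /D/= in_itv/=.
    move=> /andP[t0 t1].
    have [n _ nt] := near_infty_natSinv_lt (PosNum t0).
    exists n => //=; rewrite in_itv/= t1 andbT.
    apply: (le_trans _ (ltW (nt n _))) => /=; last exact: leqnn.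
    by rewrite lef_pV2 ?posrE ?ltr0n// ler_nat.
  move=> [n _ /=]; rewrite in_itv/= => /andP[nt ->]; rewrite andbT.
  by apply: lt_le_trans nt; rewrite invr_gt0 ltr0n.
have cvgD : (\int[mu]_(t in D n) (h a t)%:E)%E @[n --> \oo] -->
    (\int[mu]_(t in \bigcup_n D n) (h a t)%:E)%E.
  apply: ge0_nondecreasing_set_cvg_integral.
  - move=> n m nm; rewrite subsetEset; apply: subset_itvr.
    by rewrite bnd_simp lef_pV2 ?posrE ?ltr0n// ler_nat.
  - by move=> n; exact: measurable_itv.
  - by move=> n; exact: mh.
  - by move=> n t _; rewrite lee_fin.
apply: (@le_lt_trans _ _ ((1 - a)^-1)%:E); last by rewrite ltry.
rewrite -(cvg_lim _ cvgD)//; apply: lime_le; first by apply/cvg_ex; eexists; exact: cvgD.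
apply: nearW => n; have n0 : 0 < n.+2%:R^-1 :> R by rewrite invr_gt0 ltr0n.
have n1 : n.+2%:R^-1 < 1 :> R by rewrite invf_lt1 ?ltr0n// ltr1n.
apply: (@le_trans _ _ (\int[mu]_(t in D n) (t `^ (- a))%:E)%E).
  apply: ge0_le_integral => //.
  - exact: measurable_itv.
  - by move=> t _; rewrite lee_fin.
  - exact: mh.
  - apply/measurable_EFinP; apply: (@measurable_funS _ _ _ _ setT) => //.
  - move=> t; rewrite /D/= in_itv/= => /andP[nt _]; rewrite lee_fin /h addrAC subrr add0r.
    rewrite ler_piMr ?powR_ge0// -expR0 ler_expR oppr_le0.
    exact: le_trans (ltW n0) nt.
have dF t : n.+2%:R^-1 <= t <= 1 ->
    is_derive t 1 (fun t => (1 - a)^-1 * t `^ (1 - a)) (t `^ (- a)).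
  move=> /andP[nt _]; have t0 : 0 < t by exact: lt_le_trans n0 nt.
  have := is_deriveZ (1 - a)^-1 (is_derive1_powR (1 - a) t0).
  by rewrite /GRing.scale/= mulKf ?gt_eqF// addrAC subrr add0r.
rewrite (continuous_integral_FTC n1 _ dF).
  by rewrite lee_fin powR1 mulr1 gerBl mulr_ge0 ?powR_ge0// invr_ge0 ltW.
move=> t /andP[nt _]; apply: continuous_powR_gt0.
exact: lt_le_trans n0 nt.
Qed.

(** The excess [a * expR (- 1)] over [1 - expR (- 1)] is what makes [g_bar] negative. It comes from
    a minorant of the integrand with an elementary primitive. *)
Lemma gamma_bar_ge a : 0 < a < 1 ->
  1 - expR (- 1) + a * expR (- 1) <= gamma_bar a.
Proof.
move=> a01; have /andP[a0 a1] := a01.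
have mh (D : set R) : measurable_fun D (EFin \o h a).
  by apply/measurable_EFinP; exact: measurable_h.
(* [t `^ (- a) = expR (- a * ln t) >= 1 + a * (1 - t)] *)
pose q t : R := (1 + a * (1 - t)) * expR (- t).
have cq : continuous q.
  move=> t; apply: cvgM.
    apply: cvgD; first exact: cvg_cst.
    by apply: cvgMr; apply: cvgB; [exact: cvg_cst|exact: cvg_id].
  by apply: (@cvg_comp _ _ _ -%R expR _ (nbhs (- t))); [exact: opp_continuous|exact: continuous_expR].
have mq (D : set R) : measurable_fun D (EFin \o q).
  apply/measurable_EFinP; apply: (@measurable_funS _ _ _ _ setT) => //.
  exact: continuous_measurable_fun.
have intq : (\int[mu]_(t in `[0%R, 1%R]) (q t)%:E = (1 - expR (- 1) + a * expR (- 1))%:E)%E.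
  have dF t : 0 <= t <= 1 -> is_derive t 1 (fun t => (a * t - 1) * expR (- t)) (q t).
    move=> _.
    have d1 : is_derive t 1 (fun t => a * t - 1 : R) a.
      have := is_deriveB (is_deriveZ a (is_derive_id t 1)) (is_derive_cst (1 : R) t 1).
      by rewrite subr0 /GRing.scale/= mulr1.
    have d2 : is_derive t 1 (fun t => expR (- t)) (- expR (- t)).
      have := is_derive1_comp (is_derive_expR (- t)) (is_deriveN (is_derive_id t 1)).
      by rewrite mulrN1.
    have := is_deriveM d1 d2; rewrite /GRing.scale/= => dd.
    by apply: is_derive_eq dd _; rewrite /q; ring.
  rewrite (continuous_integral_FTC _ _ dF)// => [|t _]; last exact: cq.
  by congr EFin; rewrite mulr0 oppr0 expR0; ring.
rewrite -lee_fin /gamma_bar /lower_gamma /Rintegral fineK; last first.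
  rewrite ge0_fin_numE; first exact: lower_gamma_lty.
  by apply: integral_ge0 => t _; rewrite lee_fin; exact: (h_ge0 a t).
(* The endpoint 0 must go: there the power is 0 by convention, below the minorant. *)
rewrite -intq -integral_itv_obnd_cbnd; last exact: mq.
rewrite -[leRHS]integral_itv_obnd_cbnd; last exact: mh.
apply: ge0_le_integral => //.
- move=> t /=; rewrite in_itv/= => /andP[t0 t1]; rewrite lee_fin /q mulr_ge0 ?expR_ge0//.
  by rewrite addr_ge0// mulr_ge0 ?(ltW a0)// subr_ge0.
- exact: mq.
- exact: mh.
move=> t /=; rewrite in_itv/= => /andP[t0 t1]; rewrite lee_fin /q /h ler_wpM2r ?expR_ge0//.
rewrite addrAC subrr add0r /powR gt_eqF//.
apply: le_trans (expR_ge1Dx _); rewrite lerD2l mulNr -mulrN ler_wpM2l ?(ltW a0)//.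
have t1' : -1 < t - 1 by rewrite ltrBrDr addNr.
by have := le_ln1Dx t1'; rewrite addrC subrK lerNr opprB.
Qed.

Lemma g_barE a : g_bar a = 1 - expR (- 1) - gamma_bar a.
Proof. by rewrite /g_bar /g powR1 mul1r. Qed.

Lemma g_bar_lt0 a : 0 < a < 1 -> g_bar a < 0.
Proof.
move=> a01; have := gamma_bar_ge a01; have /andP[a0 _] := a01.
rewrite g_barE; have : 0 < a * expR (- 1) by rewrite mulr_gt0 ?expR_gt0.
by move: (a * expR (- 1)) (expR (- 1)) (gamma_bar a) => u v w; lra.
Qed.

(** Raise [k * t / p <= expR (k * t / p)] to the power [p]. *)
Lemma powR_le_expR p k t : 0 < p -> 0 < k -> 0 <= t ->
  t `^ p <= (p / k) `^ p * expR (k * t).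
Proof.
move=> p0 k0 t0.
have -> : expR (k * t) = (expR (k * t / p)) `^ p.
  by rewrite /powR gt_eqF ?expR_gt0// expRK; congr expR; field; rewrite gt_eqF.
rewrite -powRM ?expR_ge0 ?divr_ge0 ?(ltW p0) ?(ltW k0)//.
apply: ge0_ler_powR; rewrite ?nnegrE ?(ltW p0)//.
  by rewrite mulr_ge0 ?expR_ge0// divr_ge0 ?(ltW p0) ?(ltW k0).
have pk : 0 < p / k by rewrite divr_gt0.
rewrite -ler_pdivrMl// invf_div mulrAC.
by apply: le_trans (expR_ge1Dx _); rewrite lerDr.
Qed.

Lemma integral_expR_tail k x : 0 < k ->
  (\int[mu]_(t in `[x, +oo[) (expR (- (k * t)))%:E = (k^-1 * expR (- (k * x)))%:E)%E.
Proof.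
move=> k0; pose F t := - (k^-1 * expR (- (k * t))).
have dF t : is_derive t 1 F (expR (- (k * t))).
  have d0 : is_derive t 1 (fun t => - (k * t)) (- k).
    by have := is_deriveN (is_deriveZ k (is_derive_id t 1)); rewrite /GRing.scale/= mulr1.
  have d1 := @is_derive1_comp _ expR (fun t => - (k * t)) t _ _ (is_derive_expR _) d0.
  have := is_deriveN (is_deriveZ k^-1 d1); rewrite /GRing.scale/= => dd.
  by apply: is_derive_eq dd _; field; rewrite gt_eqF.
have cF t : {for t, continuous F}.
  by have [+ _] := dF t => /derivable1_diffP/differentiable_continuous; exact.
have cE t : {for t, continuous (fun t => expR (- (k * t)))}.
  apply: (@cvg_comp _ _ _ (fun t => - (k * t)) expR _ (nbhs (- (k * t)))); last exact: continuous_expR.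
  by apply: cvgN; apply: cvgMr; exact: cvg_id.
rewrite (@ge0_continuous_FTC2y _ (fun t => expR (- (k * t))) F x 0).
- by rewrite sub0e -EFinN /F opprK.
- by move=> t _; exact: expR_ge0.
- by apply: continuous_in_subspaceT => t _; exact: cE.
- rewrite -oppr0 -(mulr0 k^-1); apply: cvgN; apply: cvgMr.
  apply: (@cvg_comp _ _ _ (fun t => k * t) (fun u => expR (- u)) _ (pinfty_nbhs R)); last exact: cvgr_expR.
  exact: gt0_cvgMry.
- by move=> t _; have [] := dF t.
- by apply: cvg_at_right_filter; exact: cF.
- by move=> t _; rewrite derive1E; apply: derive_val.
Qed.

(** A fraction [delta] of the exponential absorbs the power of [t]; the rest is integrated
    exactly. *)
Lemma upper_gamma_le (s delta x : R) : 1 < s -> 0 < delta < 1 -> 0 <= x ->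
  0 <= upper_gamma s x <= ((s - 1) / delta) `^ (s - 1) * (1 - delta)^-1 *
    expR (- ((1 - delta) * x)).
Proof.
move=> s1 /andP[d0 d1] x0; have s0 : 0 < s - 1 by rewrite subr_gt0.
have d1' : 0 < 1 - delta by rewrite subr_gt0.
set C := _ `^ (s - 1).
have C0 : 0 <= C by exact: powR_ge0.
apply/andP; split.
  by apply: Rintegral_ge0 => t _; rewrite mulr_ge0 ?powR_ge0 ?expR_ge0.
have bound : (\int[mu]_(t in `[x, +oo[) (t `^ (s - 1) * expR (- t))%:E <=
    (C * (1 - delta)^-1 * expR (- ((1 - delta) * x)))%:E)%E.
  rewrite -mulrA EFinM -integral_expR_tail// -ge0_integralZl_EFin//.
  - apply: ge0_le_integral => //.
    + by move=> t _; rewrite lee_fin mulr_ge0 ?powR_ge0 ?expR_ge0.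
    + apply/measurable_EFinP; apply: (@measurable_funS _ _ _ _ setT) => //.
      by apply: measurable_funM => //; apply: measurableT_comp.
    + apply/measurable_EFinP; apply: (@measurable_funS _ _ _ _ setT) => //.
      apply: measurable_funM => //; apply: measurableT_comp => //.
      by apply: measurableT_comp => //; exact: mulrl_measurable.
    + move=> t /=; rewrite in_itv/= andbT => xt; rewrite lee_fin.
      have t0 : 0 <= t by exact: le_trans xt.
      have := powR_le_expR s0 d0 t0; rewrite -/C => h1.
      have -> : - ((1 - delta) * t) = delta * t - t by ring.
      by rewrite expRD mulrA ler_wpM2r ?expR_ge0.
  - apply/measurable_EFinP; apply: (@measurable_funS _ _ _ _ setT) => //.
    apply: measurableT_comp => //.
    by apply: measurableT_comp => //; exact: mulrl_measurable.
rewrite -lee_fin /upper_gamma /Rintegral fineK// ge0_fin_numE.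
  by apply: le_lt_trans bound _; rewrite ltry.
by apply: integral_ge0 => t _; rewrite lee_fin mulr_ge0 ?powR_ge0 ?expR_ge0.
Qed.

Lemma cvg_exprn_expRN (n : nat) k : 0 < k ->
  x ^+ n * expR (- (k * x)) @[x --> +oo] --> (0 : R).
Proof.
move=> k0; pose C : R := (n.+1%:R / k) `^ n.+1%:R.
have cvgC : C * x `^ (- 1) @[x --> +oo] --> (0 : R).
  by rewrite -(mulr0 C); apply: cvgMr; exact: cvg_powRN_pinfty.
apply: squeeze_cvgr (cvg_cst 0) cvgC.
have := nbhs_pinfty_gt (num_real (0 : R)); apply: filterS => x x0.
rewrite mulr_ge0 ?expR_ge0 ?exprn_ge0 ?(ltW x0)//=.
have n0 : 0 < n.+1%:R :> R by rewrite ltr0n.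
have := powR_le_expR n0 k0 (ltW x0); rewrite -/C powR_mulrn ?(ltW x0)// => h1.
rewrite powR_inv1 ?(ltW x0)// expRN ler_pdivlMr// mulrAC ler_pdivrMr ?expR_gt0//.
by rewrite -exprSr.
Qed.

Lemma K_gt0 a : 0 < a < 1 -> 0 < K a.
Proof.
move=> /andP[a0 a1]; have a2 : 0 < 2 - a by rewrite subr_gt0 (lt_trans a1)// ltr1n.
rewrite /K mulr_gt0 ?invr_gt0 ?pi_gt0// addr_gt0//.
  by rewrite divr_gt0// mulr_gt0.
by rewrite invr_gt0 exprn_gt0// /eta divr_gt0// subr_gt0.
Qed.

(* The third summand of B1; it is exponentially small since 1 - e^-1 <
   gamma_bar a. *)
Let tail_term a (m : R) := m * expR (m * (1 - expR (- 1)))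
  / (a * (m * gamma_bar a) `^ (2 / a)) * upper_gamma (2 / a) (m * gamma_bar a).

Let cvg_tail_term a : 0 < a < 1 -> m * tail_term a m @[m --> +oo] --> (0 : R).
Proof.
move=> a01; have /andP[a0 a1] := a01; have gb0 := g_bar_lt0 a01.
have e1 : 0 < 1 - expR (- 1) :> R by rewrite subr_gt0 expR_lt1 oppr_lt0.
have gE := g_barE a.
have G0 : 0 < gamma_bar a.
  by move: (g_bar a) (gamma_bar a) (1 - expR (- 1)) gE gb0 e1 => u v w; lra.
(* Chosen so that [(1 - delta) * gamma_bar a = 1 - expR (- 1) - g_bar a / 2]: against the growing
   exponential this leaves [expR (m * g_bar a / 2)], which decays. *)
pose delta := - g_bar a / (2 * gamma_bar a).
have d01 : 0 < delta < 1.
  rewrite divr_gt0 ?oppr_gt0 ?mulr_gt0//= ltr_pdivrMr ?mulr_gt0// mul1r.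
  by move: (g_bar a) (gamma_bar a) (1 - expR (- 1)) gE gb0 e1 => u v w; lra.
have s1 : 1 < 2 / a by rewrite ltr_pdivlMr// mul1r (lt_trans a1)// ltr1n.
pose C := a^-1 * (((2 / a - 1) / delta) `^ (2 / a - 1) * (1 - delta)^-1).
have k0 : 0 < - g_bar a / 2 by rewrite divr_gt0// oppr_gt0.
have cvgC : C * (m ^+ 2 * expR (- (- g_bar a / 2 * m))) @[m --> +oo] --> (0 : R).
  by rewrite -(mulr0 C); apply: cvgMr; exact: cvg_exprn_expRN.
apply: squeeze_cvgr (cvg_cst 0) cvgC.
have := nbhs_pinfty_gt (num_real (gamma_bar a)^-1); apply: filterS => m Gm.
have m0 : 0 < m by apply: lt_trans Gm; rewrite invr_gt0.
have mG1 : 1 <= m * gamma_bar a by rewrite -ler_pdivrMr// mul1r ltW.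
have mG0 : 0 <= m * gamma_bar a by rewrite mulr_ge0 ?(ltW m0) ?(ltW G0).
have Y1 : 1 <= (m * gamma_bar a) `^ (2 / a).
  have s0 : 0 <= 2 / a by rewrite divr_ge0 ?(ltW a0).
  have := ge0_ler_powR s0 (ler01 : 1 \in Num.nneg) mG0 mG1.
  by rewrite powR1.
have /andP[u0 u1] := upper_gamma_le s1 d01 mG0.
rewrite /tail_term; set Y := _ `^ (2 / a) in Y1 *; set u := upper_gamma _ _ in u0 u1 *.
have Y0 : 0 < Y by exact: lt_le_trans Y1.
have E0 := expR_gt0 (m * (1 - expR (- 1))).
set E := expR (m * _) in E0 *.
have -> : m * (m * E / (a * Y) * u) = a^-1 * m ^+ 2 * E * (u / Y).
  by field; rewrite !gt_eqF.
have -> : C * (m ^+ 2 * expR (- (- g_bar a / 2 * m))) = a^-1 * m ^+ 2 * E *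
    (((2 / a - 1) / delta) `^ (2 / a - 1) * (1 - delta)^-1 *
     expR (- ((1 - delta) * (m * gamma_bar a)))).
  have -> : expR (- (- g_bar a / 2 * m)) =
      E * expR (- ((1 - delta) * (m * gamma_bar a))).
    rewrite /E -expRD; congr expR; rewrite gE /delta gE; field.
    by rewrite gt_eqF.
  by rewrite /C; ring.
have p0 : 0 <= a^-1 * m ^+ 2 * E.
  by rewrite mulr_ge0 ?(ltW E0)// mulr_ge0 ?exprn_ge0 ?(ltW m0)// invr_ge0 ltW.
rewrite mulr_ge0 ?divr_ge0 ?(ltW Y0)//= ler_wpM2l//.
by apply: le_trans u1; rewrite ler_pdivrMr// ler_peMr.
Qed.

Lemma B1_equivalent alpha : 0 < alpha < 2 ->
  B1 c alpha / (K (alpha / 2) / g_bar (alpha / 2) ^+ 2 * (c - 1)^-1)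
    @[c --> +oo] --> (1 : R).
Proof.
move=> /andP[alpha0 alpha2]; set a := alpha / 2.
have a01 : 0 < a < 1 by rewrite divr_gt0//= ltr_pdivrMr// mul1r.
have gb0 := g_bar_lt0 a01; have K0 := K_gt0 a01.
(* The quotient in terms of [m = c - 1]: the bracket of [B1] times [m * g_bar a ^+ 2], with
   [1 + m^-1] standing for [c / (c - 1)]. Only the first summand survives. *)
pose ratio m := (1 + m `^ (- 1)) * (1 + (m * g_bar a - 1) * expR (m * g_bar a)
  + g_bar a ^+ 2 * (m * tail_term a m)).
have cvg_ratio : ratio m @[m --> +oo] --> (1 : R).
  have cvgE : (m * g_bar a - 1) * expR (m * g_bar a) @[m --> +oo] --> (0 : R).
    have k0 : 0 < - g_bar a by rewrite oppr_gt0.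
    have -> : (fun m => (m * g_bar a - 1) * expR (m * g_bar a)) =
        (fun m => g_bar a * (m ^+ 1 * expR (- (- g_bar a * m))) -
                  m ^+ 0 * expR (- (- g_bar a * m))).
      apply/funext => m; rewrite mulNr opprK expr1 expr0 mul1r [g_bar a * m]mulrC.
      by ring.
    rewrite -(subr0 (0 : R)) -{1}(mulr0 (g_bar a)).
    by apply: cvgB; [apply: cvgMr|]; exact: cvg_exprn_expRN.
  have -> : 1 = (1 + 0) * (1 + 0 + g_bar a ^+ 2 * 0) :> R by rewrite mulr0 !addr0 mulr1.
  apply: cvgM; first by apply: cvgD; [exact: cvg_cst|exact: cvg_powRN_pinfty].
  apply: cvgD; first by apply: cvgD; [exact: cvg_cst|exact: cvgE].
  by apply: cvgMr; exact: cvg_tail_term.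
have cvg_c : ratio (c - 1) @[c --> +oo] --> (1 : R).
  apply: (@cvg_comp _ _ _ (fun c => c - 1) ratio _ (pinfty_nbhs R)) => //.
  exact: cvg_addrr.
apply: cvg_trans cvg_c; apply: near_eq_cvg.
have := nbhs_pinfty_gt (num_real (1 : R)); apply: filterS => c c1 /=.
have m0 : 0 < c - 1 by rewrite subr_gt0.
rewrite /ratio powR_inv1 ?(ltW m0)// /B1 -/a -/(tail_term a (c - 1)).
move: (tail_term _ _) (expR ((c - 1) * g_bar a)) => u E.
have -> : 1 + (c - 1)^-1 = c / (c - 1) by field; rewrite gt_eqF.
by field; rewrite (lt_eqF gb0) !gt_eqF.
Qed.

End B1_asymptotics.

Unset Implicit Arguments.

Theorem corollary3 (R : realType) (alpha sigma : R)
    (d : measure_display) (T : measurableType d) (P : probability T R)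
    (W Gam : nat -> {RV P >-> R})
    (d' : measure_display) (T' : measurableType d') (P' : probability T' R)
    (Rinf : R -> {RV P' >-> R})
    (d'' : measure_display) (T'' : measurableType d'') (P'' : probability T'' R)
    (Z : {RV P'' >-> R}) :
  0 < alpha < 2 -> alpha != 1 -> 0 < sigma ->
  unit_poisson_arrivals Gam ->
  mutually_independent W ->
  (forall j, has_law (W j) (normal_prob 0 sigma)) ->
  independent_seq W Gam ->
  (forall c : R, 0 < c ->
     cvg_in_law +oo (fun e : R => truncated_RV W Gam alpha c e) (Rinf c)) ->
  has_law Z (normal_prob 0 1) ->
  (B1 c alpha / (K (alpha / 2) / g_bar (alpha / 2) ^+ 2 * (c - 1)^-1))
    @[c --> +oo] --> (1 : R)
  /\
  (fun c : R => kolmogorov_dist (standardize (S_inf sigma alpha c) (Rinf c)) Z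
     : R^o) =O_+oo (fun c : R => c^-1 : R^o).
Proof.
move=> alpha02 _ sigma0 [_ poissonG _] indW lawW indWG cvgR lawZ.
split; first exact: B1_equivalent.
(* Any [k] above [taylor_cst * ((2 - alpha) / alpha)] serves, for every [c > 0]. *)
apply/eqOP; near=> k.
have := nbhs_pinfty_gt (num_real (0 : R)); apply: filterS => c c0.
have /andP[h1 h2] := kolmogorov_standardize_le alpha02 sigma0 c0 poissonG indW
  lawW indWG (cvgR c c0) lawZ.
rewrite ger0_norm// ger0_norm ?invr_ge0 ?(ltW c0)//; apply: (le_trans h2).
by rewrite mulrA ler_wpM2r ?invr_ge0 ?(ltW c0).
Unshelve. all: end_near. Qed.
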